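(* Let $\Omega_1=(0,\infty)\times\mathbb{R}$, so $\overline{\Omega}_1=[0,\infty)\times\mathbb{R}$ (variables $(x,t)$). Let $\{r_k\}_{k=1}^\infty$ be an enumeration of all rational numbers (i.e. $k\mapsto r_k$ is a bijection from $\mathbb{Z}^+$ onto $\mathbb{Q}$). Define $u_1,u_2:\overline{\Omega}_1\to\mathbb{R}$ by $$u_1(x,t)=\sum_{k=1}^\infty e^{-2^k}e^{-2^k x}\sin\big(2^{2k+1}t-2^k x\big),\qquad u_2(x,t)=\sum_{k=1}^\infty 2^{-k}\,\Phi(x+1,t-r_k).$$ Then for $i=1,2$: $u_i\in C^\infty(\overline{\Omega}_1)\cap L^\infty(\Omega_1)$ and $u_i$ satisfies the heat equation $\partial_t u_i-\partial_x^2u_i=0$ on $\overline{\Omega}_1$. However, for every fixed $x_0\in[0,\infty)$, the function $t\mapsto u_i(x_0,t)$ is not real analytic at any point $t_0\in\mathbb{R}$.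
   Context: $\Phi$ denotes the one-dimensional heat kernel: $\Phi(x,t)=(4\pi t)^{-1/2}\exp\!\big(-\tfrac{x^2}{4t}\big)$ for $x\in\mathbb{R}$, $t>0$, and $\Phi(x,t)=0$ for $x\in\mathbb{R}$, $t\le 0$. A function of $t$ is real analytic at $t_0$ if its Taylor series at $t_0$ has positive radius of convergence and converges to the function on a neighborhood of $t_0$. *)

(* Defs.v *)
From Stdlib Require Import Reals QArith Qreals.
From Coquelicot Require Import Coquelicot.
Open Scope R_scope.

Definition Phi (x t : R) : R :=
  if Rlt_dec 0 t then / sqrt (4 * PI * t) * exp (- (x ^ 2) / (4 * t)) else 0.

Definition u1 (x t : R) : R :=
  Series (fun n : nat => let k := S n in
    exp (- 2 ^ k) * exp (- 2 ^ k * x) * sin (2 ^ (2 * k + 1) * t - 2 ^ k * x)).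

(* u2(x,t) = sum_{k>=1} 2^{-k} Phi(x+1, t - r_k); here r n stands for r_{n+1} *)
Definition u2 (r : nat -> R) (x t : R) : R :=
  Series (fun n : nat => / 2 ^ (S n) * Phi (x + 1) (t - r n)).

Definition is_derive_nonneg (g : R -> R) (x0 l : R) : Prop :=
  filterlim (fun h => (g (x0 + h) - g x0) / h)
    (within (fun h => h <> 0 /\ 0 <= x0 + h) (locally 0)) (locally l).

Definition closed_half (p : R * R) : Prop := 0 <= fst p.

(* D m n is the m-th x-derivative, n-th t-derivative of u, all continuous on
   the closed half plane: this is u in C^oo([0,oo) x R). *)
Definition smooth_family (u : R -> R -> R) (D : nat -> nat -> R -> R -> R) : Prop :=
  (forall x t, 0 <= x -> D 0%nat 0%nat x t = u x t) /\
  (forall m n x t, 0 <= x -> is_derive_nonneg (fun y => D m n y t) x (D (S m) n x t)) /\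
  (forall m n x t, 0 <= x -> is_derive (fun s => D m n x s) t (D m (S n) x t)) /\
  (forall m n x t, 0 <= x ->
     filterlim (fun p : R * R => D m n (fst p) (snd p))
       (within closed_half (locally (x, t))) (locally (D m n x t))).

Definition smooth_closed_half (u : R -> R -> R) : Prop :=
  exists D, smooth_family u D.

Definition real_analytic_at (g : R -> R) (t0 : R) : Prop :=
  (forall n, ex_derive_n g n t0) /\
  exists rho, 0 < rho /\
    forall t, Rabs (t - t0) < rho ->
      is_pseries (fun n => Derive_n g n t0 / INR (Factorial.fact n)) (t - t0) (g t).

Definition heat_props (u : R -> R -> R) : Prop :=
  (exists D, smooth_family u D /\
     forall x t, 0 <= x -> D 0%nat 1%nat x t - D 2%nat 0%nat x t = 0) /\
  (exists M, forall x t, 0 < x -> Rabs (u x t) <= M) /\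
  (forall x0 t0, 0 <= x0 -> ~ real_analytic_at (fun t => u x0 t) t0).

(* Main.v *)
Require Import Defs.
From Stdlib Require Import Reals QArith Qreals ZArith Lra Lia.
From Coquelicot Require Import Coquelicot.
Open Scope R_scope.

(** Both functions are series of smooth solutions of the heat equation whose derivatives of
    every order are bounded by the terms of a convergent series, so smoothness and the
    equation pass to the sum.

    If [u(x, .)] were analytic at [t], its [n]-th time derivatives would be at most
    [C A^n n!] near [t].  For [u1] the derivative of order about [2^k (1 + x) / 2] is dominated
    by its [k]-th term, which is of size [(n!)^2] up to exponential factors.  For [u2], let
    [S_n] be the supremum of the [n]-th time derivative of the kernel at [y = x + 1], and pick
    a rational [r_m] near [t].  At [r_m + s], where [s] nearly attains [S_n], the [m]-th term
    is nearly [2^-m S_n], the finitely many terms up to index [m + 1] are bounded by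
    [C A^n n!] since [r_m + s] stays away from their singularities, and the remaining tail is
    at most [2^-(m+1) S_n].  Hence [S_n <= C A^n n!], so the kernel, which is flat at time 0,
    would vanish for small positive times. *)

(** * Families of derivatives of heat solutions *)

Lemma Series_dominated (a b : nat -> R) :
  (forall n, Rabs (a n) <= b n) -> ex_series b ->
  ex_series a /\ Rabs (Series a) <= Series b.
Proof.
  intros Hab Hb.
  assert (Ha : ex_series (fun n => Rabs (a n))).
  { apply (ex_series_le (K := R_AbsRing) (V := R_CompleteNormedModule) _ b); trivial.
    intros n. unfold norm; simpl. unfold abs; simpl. rewrite Rabs_Rabsolu. apply Hab. }
  split.
  - now apply ex_series_Rabs.
  - eapply Rle_trans; [now apply Series_Rabs |].
    apply Series_le; trivial. intros n; split; [apply Rabs_pos | apply Hab].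
Qed.

Lemma MVT_bound (f df : R -> R) (a b M : R) :
  (forall y, Rmin a b <= y <= Rmax a b -> is_derive f y (df y) /\ Rabs (df y) <= M) ->
  Rabs (f b - f a) <= M * Rabs (b - a).
Proof.
  intros H.
  destruct (MVT_gen f a b df) as [c [Hc ->]].
  - intros y Hy. apply H. lra.
  - intros y Hy. apply continuity_pt_filterlim, (ex_derive_continuous (V := R_NormedModule) f y).
    eexists. now apply H.
  - rewrite Rabs_mult. apply Rmult_le_compat_r; [apply Rabs_pos | now apply H].
Qed.

(** The mean value bound is applied twice: [f y - y * f1 a] has derivative [f1 y - f1 a], which is
    itself at most [M * Rabs (b - a)]. The usual factor 1/2 is given up. *)
Lemma taylor2_bound (f f1 f2 : R -> R) (a b M : R) :
  (forall y, Rmin a b <= y <= Rmax a b ->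
     is_derive f y (f1 y) /\ is_derive f1 y (f2 y) /\ Rabs (f2 y) <= M) ->
  Rabs (f b - f a - (b - a) * f1 a) <= M * (b - a) ^ 2.
Proof.
  intros H.
  assert (HM : 0 <= M).
  { destruct (H a) as (_ & _ & Ha).
    - split; [apply Rmin_l | apply Rmax_l].
    - pose proof (Rabs_pos (f2 a)); lra. }
  assert (E := MVT_bound (fun y => f y - y * f1 a) (fun y => f1 y - f1 a) a b
                 (M * Rabs (b - a))).
  replace (f b - f a - (b - a) * f1 a)
    with (f b - b * f1 a - (f a - a * f1 a)) by ring.
  replace ((b - a) ^ 2) with (Rabs (b - a) * Rabs (b - a))
    by (rewrite <- (pow2_abs (b - a)); ring).
  rewrite <- Rmult_assoc. apply E. clear E.
  intros y Hy. split.
  - assert (H1 := proj1 (H y Hy)). auto_derive.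
    + now exists (f1 y).
    + replace (Derive (fun x => f x) y) with (f1 y).
      * ring.
      * symmetry. now apply is_derive_unique.
  - apply Rle_trans with (M * Rabs (y - a)).
    + apply (MVT_bound f1 f2). intros z Hz.
      assert (Hz' : Rmin a b <= z <= Rmax a b).
      { revert Hy Hz. unfold Rmin, Rmax.
        repeat destruct Rle_dec; lra. }
      split; now apply H.
    + apply Rmult_le_compat_l; trivial.
      revert Hy. unfold Rmin, Rmax, Rabs.
      repeat destruct Rle_dec; repeat destruct Rcase_abs; lra.
Qed.

(* [H k] stands for the [k]-th space derivative of a heat solution, so that [H (k + 2)] is
   also the time derivative of [H k].  Differentiability is replaced by quadratic Taylor
   estimates because these can be summed term by term. *)
Record bounded_heat_family (H : nat -> R -> R -> R) (M : nat -> R) : Prop := {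
  bhf_bound : forall k x t, 0 <= x -> Rabs (H k x t) <= M k;
  bhf_space : forall k x y t, 0 <= x -> 0 <= y ->
    Rabs (H k y t - H k x t - (y - x) * H (S k) x t) <= M (S (S k)) * (y - x) ^ 2;
  bhf_time : forall k x s t, 0 <= x ->
    Rabs (H k x t - H k x s - (t - s) * H (S (S k)) x s)
      <= M (S (S (S (S k)))) * (t - s) ^ 2 }.

Lemma bounded_heat_family_of_derive (H : nat -> R -> R -> R) (M : nat -> R) :
  (forall k x t, 0 <= x -> Rabs (H k x t) <= M k) ->
  (forall k x t, 0 <= x -> is_derive (fun y => H k y t) x (H (S k) x t)) ->
  (forall k x t, 0 <= x -> is_derive (fun s => H k x s) t (H (S (S k)) x t)) ->
  bounded_heat_family H M.
Proof.
  intros Hb Hx Ht. split; trivial.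
  - intros k x y t H0 H1.
    apply (taylor2_bound (fun y => H k y t) (fun y => H (S k) y t) (fun y => H (S (S k)) y t)).
    intros z [Hz _].
    assert (0 <= z) by (eapply Rle_trans; [| exact Hz]; now apply Rmin_glb).
    auto.
  - intros k x s t H0.
    apply (taylor2_bound (fun s => H k x s) (fun s => H (S (S k)) x s)
             (fun s => H (S (S (S (S k)))) x s)). auto.
Qed.

(** All three estimates are linear in [H], so each passes to the sum by termwise domination. *)
Lemma bounded_heat_family_series (H : nat -> nat -> R -> R -> R) (M : nat -> nat -> R) :
  (forall n, bounded_heat_family (H n) (M n)) ->
  (forall k, ex_series (fun n => M n k)) ->
  bounded_heat_family (fun k x t => Series (fun n => H n k x t))
                      (fun k => Series (fun n => M n k)).
Proof.
  intros HH HM.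
  assert (Hs : forall k x t, 0 <= x -> ex_series (fun n => H n k x t)).
  { intros k x t H0. apply (Series_dominated _ (fun n => M n k)); trivial.
    intros n. now apply (bhf_bound _ _ (HH n)). }
  assert (Hlin : forall k l x y s t h, 0 <= x -> 0 <= y ->
    Series (fun n => H n k y t) - Series (fun n => H n k x s) - h * Series (fun n => H n l x s)
    = Series (fun n => H n k y t - H n k x s - h * H n l x s)).
  { intros. rewrite Series_minus, Series_minus, Series_scal_l; auto.
    - now apply (ex_series_minus (V := R_NormedModule)); apply Hs.
    - apply (ex_series_scal (V := R_NormedModule)); auto. }
  split.
  - intros k x t H0. apply (Series_dominated _ (fun n => M n k)); trivial.
    intros n. now apply (bhf_bound _ _ (HH n)).
  - intros k x y t H0 H1. rewrite Hlin, <- Series_scal_r; trivial.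
    apply (Series_dominated _ (fun n => M n (S (S k)) * (y - x) ^ 2)).
    + intros n. now apply (bhf_space _ _ (HH n)).
    + now apply ex_series_scal_r.
  - intros k x s t H0. rewrite Hlin, <- Series_scal_r; trivial.
    apply (Series_dominated _ (fun n => M n (S (S (S (S k)))) * (t - s) ^ 2)).
    + intros n. now apply (bhf_time _ _ (HH n)).
    + now apply ex_series_scal_r.
Qed.

Lemma Rabs_quotient_bound (d l M h : R) :
  h <> 0 -> Rabs (d - h * l) <= M * h ^ 2 -> Rabs (d / h - l) <= M * Rabs h.
Proof.
  intros Hh Hd.
  assert (0 < Rabs h) by now apply Rabs_pos_lt.
  replace (d / h - l) with ((d - h * l) / h) by (field; trivial).
  unfold Rdiv. rewrite Rabs_mult, Rabs_inv.
  apply Rmult_le_reg_r with (Rabs h); trivial.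
  rewrite Rmult_assoc, Rinv_l, Rmult_1_r by lra.
  eapply Rle_trans; [exact Hd |]. right.
  rewrite <- (pow2_abs h). ring.
Qed.

Lemma bhf_is_derive_nonneg H M : bounded_heat_family H M ->
  forall k x t, 0 <= x -> is_derive_nonneg (fun y => H k y t) x (H (S k) x t).
Proof.
  intros HH k x t H0. apply filterlim_locally. intros eps.
  set (B := M (S (S k))).
  assert (HB : 0 < Rabs B + 1) by (pose proof (Rabs_pos B); lra).
  assert (Hd : 0 < eps / (Rabs B + 1)) by (apply Rdiv_lt_0_compat; [apply eps | trivial]).
  exists (mkposreal _ Hd). intros h Hh [Hh0 Hxh]. change R in (type of h).
  unfold ball in Hh |- *; simpl in Hh |- *.
  unfold AbsRing_ball, abs, minus, plus, opp in Hh |- *; simpl in Hh |- *.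
  rewrite Ropp_0, Rplus_0_r in Hh.
  apply Rle_lt_trans with (B * Rabs h).
  - apply Rabs_quotient_bound; trivial.
    assert (E := bhf_space _ _ HH k x (x + h) t H0 Hxh).
    now replace (x + h - x) with h in E by (simpl; ring).
  - apply Rle_lt_trans with ((Rabs B + 1) * Rabs h).
    + apply Rmult_le_compat_r; [apply Rabs_pos |]. pose proof (Rle_abs B); lra.
    + apply Rlt_le_trans with ((Rabs B + 1) * (eps / (Rabs B + 1))).
      * now apply Rmult_lt_compat_l.
      * right. field. lra.
Qed.

(** The difference quotient errs by at most [M * Rabs h]. Besides serving sums of families, this
    form gives differentiability of the kernel at its singular time. *)
Lemma is_derive_of_quadratic (f : R -> R) (x l M : R) :
  (forall y, Rabs (f y - f x - (y - x) * l) <= M * (y - x) ^ 2) -> is_derive f x l.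
Proof.
  intros Hf. apply is_derive_Reals. intros eps Heps.
  assert (HB : 0 < Rabs M + 1) by (pose proof (Rabs_pos M); lra).
  assert (Hd : 0 < eps / (Rabs M + 1)) by now apply Rdiv_lt_0_compat.
  exists (mkposreal _ Hd). intros h Hh0 Hh. simpl in Hh.
  apply Rle_lt_trans with (M * Rabs h).
  - apply Rabs_quotient_bound; trivial.
    specialize (Hf (x + h)). now replace (x + h - x) with h in Hf by ring.
  - apply Rle_lt_trans with ((Rabs M + 1) * Rabs h).
    + apply Rmult_le_compat_r; [apply Rabs_pos |]. pose proof (Rle_abs M); lra.
    + apply Rlt_le_trans with ((Rabs M + 1) * (eps / (Rabs M + 1))).
      * now apply Rmult_lt_compat_l.
      * right. field. lra.
Qed.

Lemma bhf_is_derive_time H M : bounded_heat_family H M ->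
  forall k x t, 0 <= x -> is_derive (fun s => H k x s) t (H (S (S k)) x t).
Proof.
  intros HH k x t H0.
  apply is_derive_of_quadratic with (M (S (S (S (S k))))).
  intros s. now apply (bhf_time _ _ HH).
Qed.

(** Trades a quadratic Taylor estimate for a Lipschitz one, since [u ^ 2 <= Rabs u] when
    [Rabs u <= 1]. *)
Lemma linear_bound (d u l P Q : R) :
  Rabs (d - u * l) <= P * u ^ 2 -> Rabs l <= Q -> Rabs u <= 1 ->
  Rabs d <= (Rabs P + Q) * Rabs u.
Proof.
  intros H1 H2 H3.
  assert (H4 : Rabs d <= Rabs (d - u * l) + Rabs u * Rabs l).
  { rewrite <- Rabs_mult. eapply Rle_trans; [| apply Rabs_triang].
    right. f_equal. ring. }
  assert (H5 : P * u ^ 2 <= Rabs P * Rabs u).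
  { apply Rle_trans with (Rabs P * u ^ 2).
    - apply Rmult_le_compat_r; [nra | apply Rle_abs].
    - apply Rmult_le_compat_l; [apply Rabs_pos |].
      rewrite <- (pow2_abs u). pose proof (Rabs_pos u). nra. }
  pose proof (Rabs_pos u). nra.
Qed.

(** The path from [(x, t)] to [(y, s)] passes through [(x, s)], so it stays in the closed half
    plane, and each leg is Lipschitz by [linear_bound]. *)
Lemma bhf_continuous H M : bounded_heat_family H M ->
  forall k x t, 0 <= x ->
  filterlim (fun p : R * R => H k (fst p) (snd p))
    (within closed_half (locally (x, t))) (locally (H k x t)).
Proof.
  intros HH k x t H0. apply filterlim_locally. intros eps.
  assert (HM : forall j, 0 <= M j).
  { intros j. eapply Rle_trans; [apply Rabs_pos | apply (bhf_bound _ _ HH j x t H0)]. }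
  (* The sum of the Lipschitz constants of the two legs. *)
  set (B := M (S k) + 2 * M (S (S k)) + M (S (S (S (S k))))).
  assert (HB : 0 < B + 1).
  { unfold B. pose proof (HM (S k)). pose proof (HM (S (S k))).
    pose proof (HM (S (S (S (S k))))). lra. }
  assert (Hd : 0 < Rmin 1 (eps / (B + 1))).
  { apply Rmin_glb_lt; [lra |]. apply Rdiv_lt_0_compat; [apply eps | trivial]. }
  exists (mkposreal _ Hd). intros [y s] [Hy Hs] Hyp. unfold closed_half in Hyp; simpl in *.
  unfold ball in Hy, Hs |- *; simpl in Hy, Hs |- *.
  unfold AbsRing_ball, abs, minus, plus, opp in Hy, Hs |- *; simpl in Hy, Hs |- *.
  fold (y - x) in Hy. fold (s - t) in Hs. fold (H k y s - H k x t).
  set (d := Rmin 1 (eps / (B + 1))) in *.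
  assert (Hd1 : d <= 1) by apply Rmin_l.
  assert (Hde : (B + 1) * d <= eps).
  { apply Rle_trans with ((B + 1) * (eps / (B + 1))).
    - apply Rmult_le_compat_l; [lra | apply Rmin_r].
    - right. field. lra. }
  assert (E1 := linear_bound _ _ _ _ _ (bhf_space _ _ HH k x y s H0 Hyp)
                  (bhf_bound _ _ HH (S k) x s H0) ltac:(lra)).
  assert (E2 := linear_bound _ _ _ _ _ (bhf_time _ _ HH k x t s H0)
                  (bhf_bound _ _ HH (S (S k)) x t H0) ltac:(lra)).
  rewrite (Rabs_pos_eq (M (S (S k)))) in E1 by trivial.
  rewrite (Rabs_pos_eq (M (S (S (S (S k)))))) in E2 by trivial.
  assert (E3 : Rabs (H k y s - H k x t)
                 <= Rabs (H k y s - H k x s) + Rabs (H k x s - H k x t)).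
  { eapply Rle_trans; [| apply Rabs_triang]. right. f_equal. ring. }
  assert (E4 : (M (S (S k)) + M (S k)) * Rabs (y - x) <= (M (S (S k)) + M (S k)) * d).
  { apply Rmult_le_compat_l; [| lra]. pose proof (HM (S k)). pose proof (HM (S (S k))). lra. }
  assert (E5 : (M (S (S (S (S k)))) + M (S (S k))) * Rabs (s - t)
                 <= (M (S (S (S (S k)))) + M (S (S k))) * d).
  { apply Rmult_le_compat_l; [| lra].
    pose proof (HM (S (S (S (S k))))). pose proof (HM (S (S k))). lra. }
  apply Rlt_le_trans with ((B + 1) * d); trivial. unfold B. lra.
Qed.

(** A time derivative counts as two space derivatives, so [D 0 1] and [D 2 0] are both [H 2] and the
    heat equation holds by construction. *)
Lemma bhf_smooth u H M : bounded_heat_family H M ->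
  (forall x t, 0 <= x -> H 0%nat x t = u x t) ->
  exists D, smooth_family u D /\
     forall x t, 0 <= x -> D 0%nat 1%nat x t - D 2%nat 0%nat x t = 0.
Proof.
  intros HH Hu. exists (fun m n => H (n + n + m)%nat). split.
  - split; [exact Hu |]. split; [| split]; intros m n x t H0.
    + replace (n + n + S m)%nat with (S (n + n + m)) by lia.
      now apply bhf_is_derive_nonneg with M.
    + replace (S n + S n + m)%nat with (S (S (n + n + m))) by lia.
      now apply bhf_is_derive_time with M.
    + now apply bhf_continuous with M.
  - intros x t _. simpl. ring.
Qed.

Lemma bhf_Derive_n H M : bounded_heat_family H M ->
  forall x, 0 <= x -> forall n t,
  Derive_n (fun s => H 0%nat x s) n t = H (n + n)%nat x t.
Proof.
  intros HH x H0 n. induction n as [| n IH]; intros t; trivial.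
  simpl Derive_n. rewrite (Derive_ext _ (fun s => H (n + n)%nat x s)) by trivial.
  apply is_derive_unique. replace (S n + S n)%nat with (S (S (n + n))) by lia.
  now apply bhf_is_derive_time with M.
Qed.

Lemma bhf_ex_derive_n H M : bounded_heat_family H M ->
  forall x, 0 <= x -> forall n t, ex_derive_n (fun s => H 0%nat x s) n t.
Proof.
  intros HH x H0 [| n] t; simpl; trivial.
  apply (ex_derive_ext (fun s => H (n + n)%nat x s)).
  - intros s. symmetry. now apply bhf_Derive_n with M.
  - eexists. now apply bhf_is_derive_time with M.
Qed.

(** * Derivative bounds for analytic functions *)

(** A binomial coefficient is at most [2 ^ (k + n)]; the induction is Pascal's rule in the form [(k
    + n)! = k (k + n - 1)! + n (k + n - 1)!]. *)
Lemma fact_add_le (n k : nat) :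
  (Factorial.fact (k + n) <= Factorial.fact k * Factorial.fact n * 2 ^ (k + n))%nat.
Proof.
  remember (k + n)%nat as m eqn:E. revert n k E.
  induction m as [| m IH]; intros n k E.
  - assert (k = 0%nat) by lia. assert (n = 0%nat) by lia. subst. simpl. lia.
  - assert (Hm : Factorial.fact (S m) = (k * Factorial.fact m + n * Factorial.fact m)%nat).
    { change (Factorial.fact (S m)) with (S m * Factorial.fact m)%nat. rewrite E. ring. }
    rewrite Hm. rewrite Nat.pow_succ_r'.
    assert (H1 : (k * Factorial.fact m
                    <= Factorial.fact k * Factorial.fact n * 2 ^ m)%nat).
    { destruct k as [| k]; [lia |].
      specialize (IH n k ltac:(lia)).
      change (Factorial.fact (S k)) with (S k * Factorial.fact k)%nat. nia. }
    assert (H2 : (n * Factorial.fact m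
                    <= Factorial.fact k * Factorial.fact n * 2 ^ m)%nat).
    { destruct n as [| n]; [lia |].
      specialize (IH n k ltac:(lia)).
      change (Factorial.fact (S n)) with (S n * Factorial.fact n)%nat. nia. }
    lia.
Qed.

Lemma Series_half : Series (fun n => (/ 2) ^ n) = 2.
Proof. rewrite Series_geom; [lra | rewrite Rabs_pos_eq; lra]. Qed.

Lemma ex_series_half : ex_series (fun n => (/ 2) ^ n).
Proof. apply ex_series_geom. rewrite Rabs_pos_eq; lra. Qed.

(** By [fact_add_le], the [k]-th term of the differentiated series is at most
    [C (2 / r)^n n! 2^(-k)] when [Rabs x <= r / 4]; the geometric sum contributes the factor 2. *)
Lemma PSeries_derive_n_bound (a : nat -> R) (C r : R) :
  0 < r -> (forall n, Rabs (a n * r ^ n) <= C) ->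
  forall n x, Rabs x <= r / 4 ->
  Rabs (Derive_n (PSeries a) n x) <= 2 * C * (2 / r) ^ n * INR (Factorial.fact n).
Proof.
  intros Hr Ha n x Hx.
  assert (HC : 0 <= C) by (eapply Rle_trans; [apply Rabs_pos | apply (Ha 0%nat)]).
  (* The point must lie strictly inside the disc of convergence; its radius is at least [r] because
     the terms [a n * r ^ n] are bounded. *)
  rewrite Derive_n_PSeries.
  2:{ apply Rbar_lt_le_trans with r; [simpl; lra |].
      apply (proj1 (CV_radius_bounded a)). now exists C. }
  set (B := C * (2 / r) ^ n * INR (Factorial.fact n)).
  replace (2 * C * (2 / r) ^ n * INR (Factorial.fact n))
    with (Series (fun k => B * (/ 2) ^ k))
    by (rewrite (Series_scal_l B (fun k => (/ 2) ^ k)), Series_half; unfold B; ring).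
  apply Series_dominated.
  2:{ apply (ex_series_scal (V := R_NormedModule)), ex_series_half. }
  intros k. unfold PS_derive_n.
  assert (Hfk : 0 < INR (Factorial.fact k)) by apply INR_fact_lt_0.
  assert (Hfn : 0 < INR (Factorial.fact n)) by apply INR_fact_lt_0.
  assert (Hf : INR (Factorial.fact (k + n)) / INR (Factorial.fact k)
                 <= INR (Factorial.fact n) * 2 ^ (k + n)).
  { apply Rle_div_l; [lra |].
    replace (2 ^ (k + n)) with (INR (2 ^ (k + n))) by (rewrite pow_INR; reflexivity).
    rewrite <- !mult_INR. apply le_INR. pose proof (fact_add_le n k). nia. }
  assert (Hf0 : 0 <= INR (Factorial.fact (k + n)) / INR (Factorial.fact k)).
  { apply Rdiv_le_0_compat; [apply pos_INR | lra]. }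
  rewrite !Rabs_mult, (Rabs_pos_eq _ Hf0), <- RPow_abs.
  assert (Hak : Rabs (a (k + n)%nat) <= C / r ^ (k + n)).
  { apply Rle_div_r; [now apply pow_lt |].
    specialize (Ha (k + n)%nat). rewrite Rabs_mult, (Rabs_pos_eq (r ^ _)) in Ha; trivial.
    apply pow_le; lra. }
  apply Rle_trans with
    (INR (Factorial.fact n) * 2 ^ (k + n) * (C / r ^ (k + n)) * (r / 4) ^ k).
  - apply Rmult_le_compat; [| apply pow_le, Rabs_pos | |].
    + apply Rmult_le_pos; [trivial | apply Rabs_pos].
    + apply Rmult_le_compat; trivial. apply Rabs_pos.
    + apply pow_incr. split; [apply Rabs_pos | trivial].
  - right. unfold B. replace (/ 2) with (2 * / r * (r / 4)) by (field; lra).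
    unfold Rdiv. rewrite !Rpow_mult_distr, !pow_add, !pow_inv.
    field. repeat apply conj; apply pow_nonzero; lra.
Qed.

Lemma real_analytic_at_bound (g : R -> R) (t0 : R) :
  real_analytic_at g t0 ->
  exists C A d, 0 < C /\ 0 < A /\ 0 < d /\
    forall n t, Rabs (t - t0) < d ->
      Rabs (Derive_n g n t) <= C * A ^ n * INR (Factorial.fact n).
Proof.
  intros [_ [rho [Hrho Hg]]].
  set (a := fun n => Derive_n g n t0 / INR (Factorial.fact n)) in Hg.
  (* The series still converges at [t0 + r], so its terms there are bounded. *)
  set (r := rho / 2).
  assert (Hr : 0 < r) by (unfold r; lra).
  assert (HC : exists C, 0 < C /\ forall n, Rabs (a n * r ^ n) <= C).
  { apply (maj_by_pos (fun n => a n * r ^ n)). exists 0. apply is_lim_seq_Reals.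
    apply ex_series_lim_0. exists (g (t0 + r)).
    assert (E : is_pseries a r (g (t0 + r))).
    { replace r with (t0 + r - t0) at 1 by ring. apply Hg.
      rewrite Rabs_pos_eq; unfold r; lra. }
    eapply is_series_ext; [| exact E].
    intros n. unfold scal; simpl. unfold mult; simpl. rewrite pow_n_pow. ring. }
  destruct HC as [C [HC Ha]].
  exists (2 * C), (2 / r), (r / 4).
  split; [lra |]. split; [apply Rdiv_lt_0_compat; lra |]. split; [lra |].
  intros n t Ht.
  (* Around [t], and not only at [t0], [g] coincides with the shifted power series: points within
     [r / 4] of [t] are within [r / 2] of [t0]. *)
  rewrite (Derive_n_ext_loc g (fun s => PSeries a (s + - t0))).
  - rewrite Derive_n_comp_trans. apply PSeries_derive_n_bound; trivial.
    unfold Rminus in Ht. lra.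
  - assert (Hd : 0 < r / 4) by lra. exists (mkposreal _ Hd). intros s Hs.
    change (Rabs (s - t) < r / 4) in Hs. symmetry. apply is_pseries_unique, Hg.
    replace (s - t0) with ((s - t) + (t - t0)) by ring.
    eapply Rle_lt_trans; [apply Rabs_triang |]. unfold r in *. lra.
Qed.

(** * Elementary estimates for exponentials and series *)

Lemma pow_le_fact_exp (x : R) (m : nat) :
  0 <= x -> x ^ m <= INR (Factorial.fact m) * exp x.
Proof.
  intros Hx. assert (Hf := INR_fact_lt_0 m).
  assert (E := exp_ge_taylor x m Hx).
  assert (H0 : x ^ m / INR (Factorial.fact m)
                 <= sum_f_R0 (fun k : nat => x ^ k / INR (Factorial.fact k)) m).
  { destruct m as [| m]; [right; reflexivity |].
    simpl sum_f_R0. rewrite <- (Rplus_0_l (_ / _)) at 1. apply Rplus_le_compat_r.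
    apply cond_pos_sum. intros k.
    apply Rdiv_le_0_compat; [now apply pow_le | apply INR_fact_lt_0]. }
  rewrite Rmult_comm. apply Rle_div_l; lra.
Qed.

(** The reverse triangle inequality, after splitting [f] into its [m]-th term [e] and the rest [f'],
    which vanishes at [m] and is dominated by [b]. *)
Lemma Series_isolate (f b : nat -> R) (m : nat) :
  (forall j, j <> m -> Rabs (f j) <= b j) -> 0 <= b m -> ex_series b ->
  Rabs (f m) - Series b <= Rabs (Series f).
Proof.
  intros Hf Hm Hb.
  set (f' := fun j => if Nat.eq_dec j m then 0 else f j).
  set (e := fun j => if Nat.eq_dec j m then f m else 0).
  assert (He : is_series e (f m)).
  { apply is_series_Reals. intros eps Heps. exists m. intros n Hn.
    replace (sum_f_R0 e n) with (f m).
    - unfold Rdist. rewrite Rminus_diag, Rabs_R0. lra.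
    - induction n as [| n IH].
      + assert (m = 0%nat) by lia. subst m. reflexivity.
      + simpl. unfold e at 2. destruct Nat.eq_dec as [E | E].
        * rewrite sum_eq_R0; [ring |].
          intros k Hk. unfold e. destruct Nat.eq_dec; [lia | trivial].
        * rewrite <- IH by lia. ring. }
  destruct (Series_dominated f' b) as [Hex Hle]; trivial.
  { intros j. unfold f'. destruct Nat.eq_dec as [-> | E]; [now rewrite Rabs_R0 | auto]. }
  assert (E : Series f = f m + Series f').
  { rewrite <- (is_series_unique _ _ He). rewrite <- Series_plus; trivial.
    - apply Series_ext. intros j. unfold e, f'. destruct Nat.eq_dec as [-> | E]; ring.
    - now exists (f m). }
  rewrite E. replace (f m) with (f m + Series f' - Series f') at 1 by ring.
  pose proof (Rabs_triang (f m + Series f') (- Series f')) as HT.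
  rewrite Rabs_Ropp in HT. unfold Rminus at 2. lra.
Qed.

(** * The lacunary series *)

(* Each space derivative of [exp (- a x) sin (2 a^2 t - a x)] multiplies the amplitude by
   [sqrt 2 a] and shifts the phase by [5 PI / 4]. *)
Definition wave (a : R) (k : nat) (x t : R) : R :=
  exp (- a) * ((sqrt 2 * a) ^ k * exp (- a * x)
    * sin (2 * a ^ 2 * t - a * x + INR k * (5 * PI / 4))).

Lemma sqrt2_bounds : 1 < sqrt 2 < 2.
Proof.
  assert (H : sqrt 2 * sqrt 2 = 2) by (apply sqrt_sqrt; lra).
  pose proof (sqrt_pos 2). split; nra.
Qed.

Lemma sin_add_5PI4 (u : R) : sqrt 2 * sin (u + 5 * PI / 4) = - (sin u + cos u).
Proof.
  replace (u + 5 * PI / 4) with (u + PI / 4 + PI) by field.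
  rewrite neg_sin, sin_plus, sin_PI4, cos_PI4. field. pose proof sqrt2_bounds. lra.
Qed.

Lemma sin_add_10PI4 (u : R) : sin (u + 5 * PI / 4 + 5 * PI / 4) = cos u.
Proof.
  replace (u + 5 * PI / 4 + 5 * PI / 4) with (PI / 2 + u + 2 * INR 1 * PI) by (simpl; field).
  now rewrite sin_period, <- cos_sin.
Qed.

Lemma wave_space a k x t : is_derive (fun y => wave a k y t) x (wave a (S k) x t).
Proof.
  unfold wave. auto_derive; trivial.
  set (u := 2 * (a * (a * 1)) * t + - (a * x) + INR k * (5 * PI / 4)).
  replace (2 * a ^ 2 * t - a * x + INR (S k) * (5 * PI / 4)) with (u + 5 * PI / 4)
    by (rewrite S_INR; unfold u; field).
  rewrite <- tech_pow_Rmult.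
  transitivity (exp (- a) * ((sqrt 2 * a) ^ k * exp (- a * x)
    * a * (sqrt 2 * sin (u + 5 * PI / 4)))); [| ring].
  rewrite sin_add_5PI4. ring.
Qed.

Lemma wave_time a k x t : is_derive (fun s => wave a k x s) t (wave a (S (S k)) x t).
Proof.
  unfold wave. auto_derive; trivial.
  set (u := 2 * (a * (a * 1)) * t + - (a * x) + INR k * (5 * PI / 4)).
  replace (2 * a ^ 2 * t - a * x + INR (S (S k)) * (5 * PI / 4))
    with (u + 5 * PI / 4 + 5 * PI / 4)
    by (rewrite !S_INR; unfold u; field).
  rewrite sin_add_10PI4, <- !tech_pow_Rmult.
  transitivity (exp (- a) * ((sqrt 2 * sqrt 2) * (a * a * (sqrt 2 * a) ^ k) * exp (- a * x)
    * cos u)); [| ring].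
  rewrite sqrt_sqrt by lra. ring.
Qed.

Lemma wave_bound a k x t : 0 <= a -> 0 <= x ->
  Rabs (wave a k x t) <= exp (- a) * (sqrt 2 * a) ^ k.
Proof.
  intros Ha Hx. unfold wave. pose proof sqrt2_bounds.
  assert (0 <= (sqrt 2 * a) ^ k) by (apply pow_le; nra).
  pose proof (exp_pos (- a)). pose proof (exp_pos (- a * x)).
  assert (exp (- a * x) <= 1).
  { rewrite <- exp_0. destruct (Req_dec (- a * x) 0) as [-> | Hn]; [lra |].
    left. apply exp_increasing. nra. }
  rewrite !Rabs_mult, (Rabs_pos_eq (exp (- a))), (Rabs_pos_eq (_ ^ _)),
    (Rabs_pos_eq (exp (- a * x))) by lra.
  apply Rmult_le_compat_l; [lra |].
  rewrite Rmult_assoc. rewrite <- (Rmult_1_r ((sqrt 2 * a) ^ k)) at 2.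
  apply Rmult_le_compat_l; [lra |].
  assert (Rabs (sin (2 * a ^ 2 * t - a * x + INR k * (5 * PI / 4))) <= 1)
    by apply Rabs_le, SIN_bound.
  pose proof (Rabs_pos (sin (2 * a ^ 2 * t - a * x + INR k * (5 * PI / 4)))). nra.
Qed.

(** From [a ^ (k + 1) <= (k + 1)! exp a] comes [exp (- a) a ^ k <= (k + 1)! / a], which is geometric
    for [a = 2 ^ (n + 1)]. *)
Lemma wave_bounds_summable k :
  ex_series (fun n => exp (- 2 ^ S n) * (sqrt 2 * 2 ^ S n) ^ k).
Proof.
  set (c := sqrt 2 ^ k * INR (Factorial.fact (S k))).
  apply (ex_series_le (K := R_AbsRing) (V := R_CompleteNormedModule) _
           (fun n => c * (/ 2) ^ n)).
  2:{ apply (ex_series_scal (V := R_NormedModule)), ex_series_half. }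
  intros n. set (a := 2 ^ S n). assert (Ha : 0 < a) by (apply pow_lt; lra).
  assert (Hs : 0 < sqrt 2 ^ k) by (apply pow_lt; pose proof sqrt2_bounds; lra).
  unfold norm; simpl. unfold abs; simpl.
  rewrite Rabs_pos_eq.
  2:{ apply Rmult_le_pos; [left; apply exp_pos | apply pow_le].
      pose proof sqrt2_bounds; nra. }
  rewrite Rpow_mult_distr, exp_Ropp.
  assert (E := pow_le_fact_exp a (S k) ltac:(lra)). rewrite <- tech_pow_Rmult in E.
  pose proof (exp_pos a) as He.
  apply Rmult_le_reg_l with (a * exp a); [nra |].
  replace (a * exp a * (/ exp a * (sqrt 2 ^ k * a ^ k))) with (sqrt 2 ^ k * (a * a ^ k))
    by (field; lra).
  replace (a * exp a * (c * (/ 2) ^ n))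
    with (sqrt 2 ^ k * (2 * (INR (Factorial.fact (S k)) * exp a))).
  - apply Rmult_le_compat_l; [lra |].
    assert (0 <= a * a ^ k) by (apply Rmult_le_pos; [lra | apply pow_le; lra]). lra.
  - unfold c, a. rewrite <- (tech_pow_Rmult 2), pow_inv. field. apply pow_nonzero. lra.
Qed.

Lemma wave_family n : bounded_heat_family (wave (2 ^ S n))
  (fun k => exp (- 2 ^ S n) * (sqrt 2 * 2 ^ S n) ^ k).
Proof.
  apply bounded_heat_family_of_derive; intros k x t Hx.
  - apply wave_bound; trivial. apply pow_le. lra.
  - apply wave_space.
  - apply wave_time.
Qed.

Lemma wave_series_family : bounded_heat_family
  (fun k x t => Series (fun n => wave (2 ^ S n) k x t))
  (fun k => Series (fun n => exp (- 2 ^ S n) * (sqrt 2 * 2 ^ S n) ^ k)).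
Proof.
  apply (bounded_heat_family_series (fun n => wave (2 ^ S n))
           (fun n k => exp (- 2 ^ S n) * (sqrt 2 * 2 ^ S n) ^ k)).
  - exact wave_family.
  - exact wave_bounds_summable.
Qed.

Lemma u1_wave_series x t : u1 x t = Series (fun n => wave (2 ^ S n) 0 x t).
Proof.
  unfold u1. apply Series_ext. intros n. cbv zeta.
  replace (2 ^ (2 * S n + 1)) with (2 * (2 ^ S n) ^ 2).
  2:{ rewrite pow_add, (Nat.mul_comm 2), pow_mult. simpl. ring. }
  unfold wave. generalize (2 ^ S n). intros a. rewrite INR_0, Rmult_0_l, Rplus_0_r, pow_O. ring.
Qed.

(** * Dominance of one frequency and non-analyticity of the sine series *)

Lemma one_sin_large (u : R) : /2 <= Rabs (sin u) \/ / 2 <= Rabs (cos u).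
Proof.
  pose proof (sin2_cos2 u) as E. unfold Rsqr in E.
  destruct (Rle_dec (/ 2) (Rabs (sin u))) as [| H1]; [now left |].
  destruct (Rle_dec (/ 2) (Rabs (cos u))) as [| H2]; [now right |].
  exfalso. apply Rnot_le_lt, Rabs_def2 in H1. apply Rnot_le_lt, Rabs_def2 in H2. nra.
Qed.

(** With truncated subtraction the exponent is the distance between [j] and [k]. The terms after [k]
    sum to 1/7 and those before it to [(1 - 8^(-k)) / 7]. *)
Lemma is_series_two_sided_eighth (k : nat) :
  exists l, l <= 2 / 7 /\
  is_series (fun j => if Nat.eq_dec j k then 0 else (/ 8) ^ (j - k + (k - j))) l.
Proof.
  enough (H : is_series (fun j => if Nat.eq_dec j k then 0 else (/ 8) ^ (j - k + (k - j)))
                (2 / 7 - (/ 8) ^ k / 7)).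
  { exists (2 / 7 - (/ 8) ^ k / 7). split; trivial.
    assert (0 < (/ 8) ^ k) by (apply pow_lt; lra). lra. }
  induction k as [| k IH].
  - apply is_series_decr_1. simpl.
    unfold plus, opp; simpl.
    replace (2 / 7 - 1 / 7 + - 0) with (/ 8 * / (1 - / 8)) by field.
    eapply is_series_ext; [| apply (is_series_scal (V := R_NormedModule) (/ 8)),
       is_series_geom; rewrite Rabs_pos_eq; lra].
    intros j. unfold scal; simpl. unfold mult; simpl.
    now rewrite Nat.add_0_r.
  - apply is_series_decr_1. unfold plus, opp; simpl.
    replace (2 / 7 - / 8 * (/ 8) ^ k / 7 + - (/ 8 * (/ 8) ^ k))
      with (2 / 7 - (/ 8) ^ k / 7) by field.
    eapply is_series_ext; [| exact IH]. intros j. simpl.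
    destruct (Nat.eq_dec j k), (Nat.eq_dec (S j) (S k)); try lia; trivial.
Qed.

Lemma two_sided_decay (T : nat -> R) (q : R) (k : nat) :
  0 <= q ->
  (forall j, (k <= j)%nat -> T (S j) <= q * T j) ->
  (forall j, (j < k)%nat -> T j <= q * T (S j)) ->
  forall j, T j <= T k * q ^ (j - k + (k - j)).
Proof.
  intros Hq Hup Hdown j.
  destruct (Nat.le_gt_cases k j) as [Hj | Hj].
  - replace j with (k + (j - k))%nat at 1 by lia. rewrite (proj2 (Nat.sub_0_le k j) Hj), Nat.add_0_r.
    clear Hj. induction (j - k)%nat as [| d IH].
    + rewrite Nat.add_0_r. simpl. lra.
    + rewrite Nat.add_succ_r. eapply Rle_trans; [apply Hup; lia |].
      simpl. apply Rle_trans with (q * (T k * q ^ d)); [| right; ring].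
      now apply Rmult_le_compat_l.
  - rewrite (proj2 (Nat.sub_0_le j k)) by lia. simpl.
    assert (E : forall d, (d <= k)%nat -> T (k - d)%nat <= T k * q ^ d).
    { intros d. induction d as [| d IH]; intros Hd.
      + rewrite Nat.sub_0_r. simpl. lra.
      + eapply Rle_trans; [apply Hdown; lia |].
        replace (S (k - S d)) with (k - d)%nat by lia.
        simpl. apply Rle_trans with (q * (T k * q ^ d)); [| right; ring].
        apply Rmult_le_compat_l; [trivial | apply IH; lia]. }
    specialize (E (k - j)%nat ltac:(lia)).
    now replace (k - (k - j))%nat with j in E by lia.
Qed.

Lemma exp_le_mono (x y : R) : x <= y -> exp x <= exp y.
Proof. intros [H | ->]; [left; now apply exp_increasing | right; reflexivity]. Qed.

Lemma eight_le_exp_3 : 8 <= exp 3.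
Proof.
  assert (H : 2 < exp 1) by (pose proof (exp_ineq1 1 ltac:(lra)); lra).
  replace 3 with (1 + 1 + 1) by ring. rewrite !exp_plus. nra.
Qed.

Lemma ln_2_lt_1 : ln 2 < 1.
Proof.
  rewrite <- (ln_exp 1). apply ln_increasing; [lra |].
  pose proof (exp_ineq1 1 ltac:(lra)); lra.
Qed.

Lemma wave_even_order (a : R) (N : nat) (x t : R) :
  wave a (N + N) x t = exp (- a * (1 + x)) * (2 * a ^ 2) ^ N
    * sin (2 * a ^ 2 * t - a * x + INR N * (5 * PI / 4 + 5 * PI / 4)).
Proof.
  unfold wave. rewrite plus_INR.
  replace (2 * a ^ 2 * t - a * x + INR N * (5 * PI / 4 + 5 * PI / 4))
    with (2 * a ^ 2 * t - a * x + (INR N + INR N) * (5 * PI / 4)) by ring.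
  generalize (sin (2 * a ^ 2 * t - a * x + (INR N + INR N) * (5 * PI / 4))). intros w.
  replace (- a * (1 + x)) with (- a + - a * x) by ring. rewrite exp_plus.
  replace (2 * a ^ 2) with ((sqrt 2 * a) * (sqrt 2 * a)).
  2:{ transitivity (sqrt 2 * sqrt 2 * a ^ 2); [ring | now rewrite sqrt_sqrt by lra]. }
  generalize (sqrt 2 * a). intros s. rewrite Rpow_mult_distr, pow_add. ring.
Qed.

(* The amplitude of the frequency [2 a^2] in the [N]-th time derivative,
   [exp (- a b) (2 a^2)^N], peaks at [a b = 2 N]: replacing [a] by [2 a] multiplies it by
   [4^N exp (- a b)]. *)
Lemma wave_series_lower_bound (x t : R) : 0 <= x ->
  exists B, forall k, B <= 2 ^ S k ->
  exists N, (1 <= N)%nat /\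
    2 ^ S k * (1 + x) <= 2 * INR N <= 2 ^ S k * (1 + x) + 6 /\
    exp (- 2 ^ S k * (1 + x)) * (2 * (2 ^ S k) ^ 2) ^ N / 8
      <= Rabs (Series (fun n => wave (2 ^ S n) (N + N) x t)).
Proof.
  intros Hx.
  pose proof ln_2_lt_1 as Hc1. pose proof ln_lt_2 as Hc2. set (c := ln 2) in *.
  (* These summands force [m (1 - c) >= 9] and [m (c - 1/2) >= 3], which make consecutive amplitudes
     differ by a factor of at least [exp 3] on both sides of [k]. *)
  exists (9 / (1 - c) + 3 / (c - / 2)). intros k Hk.
  set (a := 2 ^ S k) in *. set (m := a * (1 + x)).
  assert (P1 : 0 < 9 / (1 - c)) by (apply Rdiv_lt_0_compat; lra).
  assert (P2 : 0 < 3 / (c - / 2)) by (apply Rdiv_lt_0_compat; lra).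
  assert (Ham : a <= m) by (unfold m; nra).
  assert (Hm1 : 9 <= m * (1 - c)) by (apply Rle_div_l; lra).
  assert (Hm2 : 3 <= m * (c - / 2)) by (apply Rle_div_l; lra).
  assert (HN0 : exists N0, m <= 2 * INR N0 <= m + 2).
  { destruct (archimed (m / 2)) as [H1 H2].
    exists (Z.to_nat (up (m / 2))). rewrite INR_IZR_INZ, Z2Nat.id; [lra |].
    apply le_IZR. lra. }
  destruct HN0 as [N0 HN0].
  set (ph := fun N => 2 * a ^ 2 * t - a * x + INR N * (5 * PI / 4 + 5 * PI / 4)).
  (* Raising the order by one shifts the phase by [5 PI / 2], which turns the sine into a cosine, so
     one of two consecutive orders has a large sine. *)
  assert (HN : exists N, m <= 2 * INR N <= m + 6 /\ / 2 <= Rabs (sin (ph N))).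
  { destruct (one_sin_large (ph N0)) as [H | H].
    - exists N0. split; [lra | trivial].
    - exists (S N0). rewrite <- sin_add_10PI4 in H.
      replace (ph N0 + 5 * PI / 4 + 5 * PI / 4) with (ph (S N0)) in H
        by (unfold ph; rewrite S_INR; field).
      split; [rewrite S_INR; lra | trivial]. }
  destruct HN as [N [HN Hph]]. exists N.
  split; [apply INR_le; simpl; nra |]. split; [exact HN |].
  set (T := fun j => exp (- 2 ^ S j * (1 + x)) * (2 * (2 ^ S j) ^ 2) ^ N).
  assert (HT : forall j, 0 < T j).
  { intros j. apply Rmult_lt_0_compat; [apply exp_pos | apply pow_lt].
    assert (0 < 2 ^ S j) by (apply pow_lt; lra). nra. }
  assert (Hratio : forall j, T (S j) = T j * exp (2 * INR N * c - 2 ^ S j * (1 + x))).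
  { intros j. unfold T. rewrite <- (tech_pow_Rmult 2 (S j)). set (b := 2 ^ S j).
    replace (2 * INR N * c - b * (1 + x)) with (INR (N + N) * c + - b * (1 + x))
      by (rewrite plus_INR; ring).
    replace (- (2 * b) * (1 + x)) with (- b * (1 + x) + - b * (1 + x)) by ring.
    rewrite !exp_plus.
    change (exp (INR (N + N) * c)) with (Rpower 2 (INR (N + N))).
    rewrite Rpower_pow, pow_add by lra.
    replace (2 * (2 * b) ^ 2) with (2 * (2 * (2 * b ^ 2))) by ring.
    rewrite (Rpow_mult_distr 2 (2 * (2 * b ^ 2))), (Rpow_mult_distr 2 (2 * b ^ 2)). ring. }
  assert (Hdecay := two_sided_decay T (/ 8) k ltac:(lra)).
  assert (Hpow : forall i j, (i <= j)%nat -> 2 ^ S i * (1 + x) <= 2 ^ S j * (1 + x)).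
  { intros i j Hij. apply Rmult_le_compat_r; [lra |]. apply Rle_pow; [lra | lia]. }
  assert (He8 := eight_le_exp_3).
  (* From [k] upwards the exponent in [Hratio] is at most [6 c - m (1 - c)], hence below -3. *)
  specialize (Hdecay
    ltac:(intros j Hj; rewrite Hratio, Rmult_comm;
          apply Rmult_le_compat_r; [left; apply HT |];
          apply Rle_trans with (/ exp 3);
          [ rewrite <- exp_Ropp; apply exp_le_mono; specialize (Hpow _ _ Hj); fold a m in Hpow; nra
          | apply Rinv_le_contravar; lra])).
  (* Below [k], [2 ^ S j * (1 + x)] is at most [m / 2], so the exponent is at least
     [m (c - 1/2) >= 3]. *)
  specialize (Hdecay
    ltac:(intros j Hj; rewrite Hratio;
          specialize (Hpow (S j) k Hj); fold a m in Hpow;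
          rewrite <- (tech_pow_Rmult 2 (S j)) in Hpow;
          assert (exp 3 <= exp (2 * INR N * c - 2 ^ S j * (1 + x)))
            by (apply exp_le_mono; nra);
          specialize (HT j); nra)).
  destruct (is_series_two_sided_eighth k) as [l [Hl Hls]].
  assert (Hls' : is_series
    (fun j => T k * (if Nat.eq_dec j k then 0 else (/ 8) ^ (j - k + (k - j)))) (T k * l))
    by exact (is_series_scal (V := R_NormedModule) (T k) _ _ Hls).
  assert (E := Series_isolate (fun n => wave (2 ^ S n) (N + N) x t)
    (fun j => T k * (if Nat.eq_dec j k then 0 else (/ 8) ^ (j - k + (k - j)))) k).
  rewrite (is_series_unique _ (T k * l) Hls') in E.
  assert (Hw : forall j, Rabs (wave (2 ^ S j) (N + N) x t) = T j *
     Rabs (sin (2 * (2 ^ S j) ^ 2 * t - 2 ^ S j * x + INR N * (5 * PI / 4 + 5 * PI / 4)))).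
  { intros j. rewrite wave_even_order, Rabs_mult. now rewrite (Rabs_pos_eq (_ * _)) by (left; apply HT). }
  (* Term [k] contributes at least [T k / 2] and all others together at most [2 / 7 * T k]; the
     difference, [3 / 14 * T k], exceeds [T k / 8]. *)
  eapply Rle_trans; [| apply E].
  - rewrite Hw. fold a. fold (ph N). fold (T k). pose proof (HT k).
    assert (T k * l <= T k * (2 / 7)) by (apply Rmult_le_compat_l; lra).
    assert (T k * / 2 <= T k * Rabs (sin (ph N))) by (apply Rmult_le_compat_l; lra).
    change (exp (- a * (1 + x)) * (2 * a ^ 2) ^ N) with (T k). lra.
  - intros j Hj. rewrite Hw. destruct (Nat.eq_dec j k) as [E0 | _]; [now contradiction Hj |].
    eapply Rle_trans; [| apply Hdecay]. rewrite <- (Rmult_1_r (T j)) at 2.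
    apply Rmult_le_compat_l; [left; apply HT | apply Rabs_le, SIN_bound].
  - destruct (Nat.eq_dec k k) as [_ | E0]; [lra | now contradiction E0].
  - eexists. exact Hls'.
Qed.

Lemma fact_le_pow (n : nat) : INR (Factorial.fact n) <= INR n ^ n.
Proof.
  rewrite <- pow_INR. apply le_INR.
  enough (H : forall p, (n <= p)%nat -> (Factorial.fact n <= p ^ n)%nat) by (apply H; lia).
  induction n as [| n IH]; intros p Hp; [simpl; lia |].
  specialize (IH p ltac:(lia)).
  change (Factorial.fact (S n)) with (S n * Factorial.fact n)%nat.
  rewrite Nat.pow_succ_r'. nia.
Qed.

(** At the order [N] found above, the dominant amplitude is at least [(exp (- 2) a ^ 2) ^ N],
    whereas [N! <= m ^ N]. Since [a] is proportional to [m], the quotient by [A ^ N * N!] is at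
    least [(D * m) ^ N], which outgrows every constant. *)
Lemma u1_not_analytic x t : 0 <= x -> ~ real_analytic_at (fun s => u1 x s) t.
Proof.
  intros Hx Han.
  destruct (real_analytic_at_bound _ _ Han) as (C & A & d & HC & HA & Hd & Hbound).
  destruct (wave_series_lower_bound x t Hx) as [B HB].
  (* Chosen so that [D * m * (A * m) = exp (- 2) * a ^ 2]. *)
  set (D := exp (- 2) / ((1 + x) ^ 2 * A)).
  assert (HD : 0 < D).
  { apply Rdiv_lt_0_compat; [apply exp_pos |]. apply Rmult_lt_0_compat; [nra | trivial]. }
  (* The threshold 6 gives [2 N <= m + 6 <= 2 m], hence [N <= m]; the last one gives
     [D * m >= 8 * C + 1], which beats both [C] and the factor 1/8 of the lower bound. *)
  destruct (Pow_x_infinity 2 ltac:(rewrite Rabs_pos_eq; lra) (Rmax B (Rmax 6 ((8 * C + 1) / D))))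
    as [k Hk].
  specialize (Hk (S k) ltac:(lia)). rewrite Rabs_pos_eq in Hk by (apply pow_le; lra).
  assert (Hk1 := Rmax_l B (Rmax 6 ((8 * C + 1) / D))).
  assert (Hk2 := Rmax_r B (Rmax 6 ((8 * C + 1) / D))).
  assert (Hk3 := Rmax_l 6 ((8 * C + 1) / D)).
  assert (Hk4 := Rmax_r 6 ((8 * C + 1) / D)).
  destruct (HB k ltac:(lra)) as (N & HN1 & HN & Hlow). clear HB.
  set (a := 2 ^ S k) in *. set (m := a * (1 + x)) in *.
  assert (Ham : a <= m) by (unfold m; nra).
  specialize (Hbound N t). rewrite Rminus_diag, Rabs_R0 in Hbound. specialize (Hbound Hd).
  rewrite (Derive_n_ext (fun s => u1 x s) _ N t (u1_wave_series x)) in Hbound.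
  rewrite (bhf_Derive_n _ _ wave_series_family x Hx) in Hbound.
  assert (Hfact : INR (Factorial.fact N) <= m ^ N).
  { eapply Rle_trans; [apply fact_le_pow |]. apply pow_incr. split; [apply pos_INR | lra]. }
  assert (HAN : 0 < A ^ N) by now apply pow_lt.
  assert (Hexp : exp (- 2) ^ N <= exp (- a * (1 + x))).
  { rewrite <- Rpower_pow by apply exp_pos. unfold Rpower. rewrite ln_exp.
    apply exp_le_mono. unfold m in HN. lra. }
  assert (HmN : 0 < m ^ N) by (apply pow_lt; lra).
  assert (Hpow : (D * m) ^ N * (A * m) ^ N <= exp (- a * (1 + x)) * (2 * a ^ 2) ^ N).
  { rewrite <- Rpow_mult_distr.
    replace (D * m * (A * m)) with (exp (- 2) * a ^ 2) by (unfold D, m; field; lra).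
    rewrite Rpow_mult_distr.
    apply Rmult_le_compat; trivial.
    - apply pow_le; left; apply exp_pos.
    - apply pow_le; nra.
    - apply pow_incr. pose proof (pow2_ge_0 a). lra. }
  assert (HDm : 8 * C + 1 <= D * m).
  { rewrite (Rmult_comm D). apply Rle_div_l; lra. }
  assert (Hbig : D * m <= (D * m) ^ N).
  { rewrite <- (pow_1 (D * m)) at 1. apply Rle_pow; [lra | lia]. }
  assert (HAm : 0 < (A * m) ^ N) by (apply pow_lt; nra).
  assert (H1 : C * A ^ N * INR (Factorial.fact N) <= C * (A * m) ^ N).
  { rewrite Rpow_mult_distr, Rmult_assoc. apply Rmult_le_compat_l; [lra |].
    apply Rmult_le_compat_l; lra. }
  assert (H2 : (8 * C + 1) * (A * m) ^ N <= (D * m) ^ N * (A * m) ^ N)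
    by (apply Rmult_le_compat_r; lra).
  lra.
Qed.

(** * Space derivatives of the heat kernel *)

(* The [k]-th space derivative of the heat kernel, by the three-term recurrence obtained
   from differentiating [Phi_x = - x / (2 t) Phi]; it vanishes for [t <= 0]. *)
Fixpoint Phi_deriv (k : nat) (y t : R) : R :=
  match k with
  | O => Phi y t
  | S O => - / (2 * t) * (y * Phi y t)
  | S (S j as i) => - / (2 * t) * (y * Phi_deriv i y t + INR i * Phi_deriv j y t)
  end.

(** Puts the recurrence in one uniform form: at [k = 0] the value [pred 0 = 0] is harmless because
    its coefficient [INR k] is zero. *)
Lemma Phi_deriv_S k y t : Phi_deriv (S k) y t
  = - / (2 * t) * (y * Phi_deriv k y t + INR k * Phi_deriv (pred k) y t).
Proof. destruct k as [| k]; [simpl; ring | reflexivity]. Qed.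

(** Induction fitted to the three-term recurrence in the form of [Phi_deriv_S]. *)
Lemma nat_ind_pred (P : nat -> Prop) :
  P 0%nat -> (forall k, P k -> P (pred k) -> P (S k)) -> forall k, P k.
Proof.
  intros H0 HS k. induction k as [k IH] using lt_wf_ind.
  destruct k as [| k]; trivial. apply HS; apply IH; lia.
Qed.

Lemma Phi_deriv_nonpos k y t : t <= 0 -> Phi_deriv k y t = 0.
Proof.
  intros Ht. induction k as [| k H1 H2] using nat_ind_pred.
  - simpl. unfold Phi. destruct Rlt_dec; [lra | trivial].
  - rewrite Phi_deriv_S, H1, H2. ring.
Qed.

Lemma Phi_pos_eq y t : 0 < t ->
  Phi y t = / sqrt (4 * PI * t) * exp (- (y ^ 2) / (4 * t)).
Proof. intros Ht. unfold Phi. destruct Rlt_dec; [trivial | lra]. Qed.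

Lemma Phi_gt_0 y t : 0 < t -> 0 < Phi y t.
Proof.
  intros Ht. rewrite Phi_pos_eq by trivial. pose proof PI_RGT_0.
  apply Rmult_lt_0_compat; [apply Rinv_0_lt_compat, sqrt_lt_R0; nra | apply exp_pos].
Qed.

Lemma Phi_space y t : 0 < t ->
  is_derive (fun x => Phi x t) y (- / (2 * t) * (y * Phi y t)).
Proof.
  intros Ht. rewrite Phi_pos_eq by trivial.
  apply (is_derive_ext (fun x => / sqrt (4 * PI * t) * exp (- (x ^ 2) / (4 * t)))).
  { intros x. now rewrite Phi_pos_eq. }
  pose proof PI_RGT_0. assert (Hs : 0 < sqrt (4 * PI * t)) by (apply sqrt_lt_R0; nra).
  auto_derive; trivial. simpl. unfold Rdiv. field. lra.
Qed.

Lemma Phi_time y t : 0 < t ->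
  is_derive (fun s => Phi y s) t (Phi_deriv 2 y t).
Proof.
  intros Ht. rewrite !Phi_deriv_S. simpl. rewrite Phi_pos_eq by trivial.
  apply (is_derive_ext_loc (fun s => / sqrt (4 * PI * s) * exp (- (y ^ 2) / (4 * s)))).
  { exists (mkposreal _ Ht). intros s Hs.
    change (Rabs (s - t) < t) in Hs. apply Rabs_def2 in Hs.
    rewrite Phi_pos_eq; [trivial | lra]. }
  pose proof PI_RGT_0 as HPI. assert (Hq : 0 < 4 * PI * t) by nra.
  pose proof (sqrt_lt_R0 _ Hq) as Hs.
  assert (E : 4 * PI * t = sqrt (4 * PI * t) * sqrt (4 * PI * t))
    by (symmetry; apply sqrt_sqrt; lra).
  auto_derive.
  - repeat apply conj; trivial; lra.
  - set (w := sqrt (4 * PI * t)) in *.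
    (* Expressing [PI] through the root [w] leaves an identity of rational functions, within reach
       of [field]. *)
    assert (EP : PI = w * w / (4 * t)) by (rewrite <- E; field; lra).
    simpl. rewrite EP. unfold Rdiv. clearbody w. field. lra.
Qed.

(** Differentiating the factor [y] in the recurrence produces one more copy of [Phi_deriv k], which
    raises its coefficient from [k] to [k + 1]. *)
Lemma Phi_deriv_space k y t : 0 < t ->
  is_derive (fun x => Phi_deriv k x t) y (Phi_deriv (S k) y t).
Proof.
  intros Ht. induction k as [| k H1 H2] using nat_ind_pred.
  - now apply Phi_space.
  - eapply is_derive_ext; [intros x; symmetry; apply Phi_deriv_S |].
    auto_derive.
    + repeat apply conj; trivial; eexists; [exact H1 | exact H2].
    + rewrite (is_derive_unique (fun x : R => Phi_deriv k x t) _ _ H1),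
        (is_derive_unique (fun x : R => Phi_deriv (pred k) x t) _ _ H2).
      rewrite (Phi_deriv_S (S k)), S_INR. simpl pred.
      destruct k as [| k]; simpl pred; [simpl; ring | ring].
Qed.

(** In the recurrence for order [k + 1], differentiating [- / (2 * t)] contributes
    [- / t * Phi_deriv (S k) y t]: the two copies that raise the coefficient from [k] to [k + 2]. *)
Lemma Phi_deriv_time k y t : 0 < t ->
  is_derive (fun s => Phi_deriv k y s) t (Phi_deriv (S (S k)) y t).
Proof.
  intros Ht. induction k as [| k H1 H2] using nat_ind_pred.
  - now apply Phi_time.
  - eapply is_derive_ext; [intros x; symmetry; apply Phi_deriv_S |].
    auto_derive.
    + repeat apply conj; trivial; try (eexists; [exact H1 || exact H2]); lra.
    + rewrite (is_derive_unique (fun s : R => Phi_deriv k y s) _ _ H1),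
        (is_derive_unique (fun s : R => Phi_deriv (pred k) y s) _ _ H2).
      rewrite (Phi_deriv_S (S (S k))), !S_INR. simpl pred.
      destruct k as [| k]; simpl pred.
      * simpl. field. lra.
      * rewrite (Phi_deriv_S (S k)), S_INR. simpl pred. field. lra.
Qed.

(** As [y >= 1], both [y / t] and [/ t] are at most [z = y ^ 2 / t], so one step of the recurrence
    costs at most a factor [(k + 1) (1 + z)]. *)
Lemma Phi_deriv_le_Phi k y t : 1 <= y -> 0 < t ->
  Rabs (Phi_deriv k y t) <= INR (Factorial.fact k) * (1 + y ^ 2 / t) ^ k * Phi y t.
Proof.
  intros Hy Ht. set (z := y ^ 2 / t). assert (HPhi := Phi_gt_0 y t Ht).
  assert (Ht' : 0 < / t) by now apply Rinv_0_lt_compat.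
  assert (Hyt : y / t <= z) by (unfold z, Rdiv; apply Rmult_le_compat_r; [lra | nra]).
  assert (H1t : / t <= y / t) by (unfold Rdiv; nra).
  induction k as [| k H1 H2] using nat_ind_pred.
  - simpl. rewrite Rabs_pos_eq; lra.
  - rewrite Phi_deriv_S, Rabs_mult, Rabs_Ropp, Rinv_mult, (Rabs_pos_eq (/ 2 * / t)) by lra.
    set (F := INR (Factorial.fact k) * (1 + z) ^ k * Phi y t) in *.
    assert (HF : 0 <= F).
    { unfold F. repeat apply Rmult_le_pos; try apply pos_INR; [apply pow_le |]; lra. }
    assert (H3 : INR k * Rabs (Phi_deriv (pred k) y t) <= F).
    { eapply Rle_trans; [apply Rmult_le_compat_l; [apply pos_INR | exact H2] |].
      unfold F. rewrite <- !Rmult_assoc. apply Rmult_le_compat_r; [lra |].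
      destruct k as [| k]; [simpl; lra |]. simpl pred.
      change (Factorial.fact (S k)) with (S k * Factorial.fact k)%nat. rewrite mult_INR.
      apply Rmult_le_compat_l; [apply Rmult_le_pos; apply pos_INR |].
      apply Rle_pow; [lra | lia]. }
    apply Rle_trans with (z * F).
    + apply Rle_trans with (/ 2 * / t * (y * F + F)).
      * apply Rmult_le_compat_l; [lra |].
        eapply Rle_trans; [apply Rabs_triang |].
        rewrite !Rabs_mult, (Rabs_pos_eq y), (Rabs_pos_eq (INR k)) by (lra || apply pos_INR).
        apply Rplus_le_compat; [apply Rmult_le_compat_l; lra | exact H3].
      * replace (/ 2 * / t * (y * F + F)) with ((y / t + / t) / 2 * F) by (field; lra).
        apply Rmult_le_compat_r; lra.
    + change (Factorial.fact (S k)) with (S k * Factorial.fact k)%nat.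
      rewrite mult_INR, <- tech_pow_Rmult.
      replace (INR (S k) * INR (Factorial.fact k) * ((1 + z) * (1 + z) ^ k) * Phi y t)
        with (INR (S k) * (1 + z) * F) by (unfold F; ring).
      apply Rmult_le_compat_r; trivial. rewrite S_INR. pose proof (pos_INR k). nra.
Qed.

(** The singular prefactor is absorbed by [1 + z]: from [/ t <= z] follows
    [4 PI t (1 + z)^2 >= 4 PI > 1]. *)
Lemma Phi_le y t : 1 <= y -> 0 < t ->
  Phi y t <= (1 + y ^ 2 / t) * exp (- (y ^ 2 / t) / 4).
Proof.
  intros Hy Ht. rewrite Phi_pos_eq by trivial.
  replace (- y ^ 2 / (4 * t)) with (- (y ^ 2 / t) / 4) by (field; lra).
  apply Rmult_le_compat_r; [left; apply exp_pos |].
  assert (Ht' : 0 < / t) by now apply Rinv_0_lt_compat.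
  assert (Hz : / t <= y ^ 2 / t).
  { rewrite <- (Rmult_1_l (/ t)). apply Rmult_le_compat_r; [lra | nra]. }
  set (z := y ^ 2 / t) in *. clearbody z.
  pose proof PI2_1. assert (HPI : 1 < PI) by lra.
  assert (Hq : 0 < 4 * PI * t) by nra.
  apply Rmult_le_reg_l with (sqrt (4 * PI * t)); [now apply sqrt_lt_R0 |].
  rewrite Rinv_r by now apply Rgt_not_eq, sqrt_lt_R0.
  rewrite <- (sqrt_pow2 (1 + z)) by lra. rewrite <- sqrt_mult by (try apply pow2_ge_0; lra).
  rewrite <- sqrt_1 at 1. apply sqrt_le_1_alt.
  assert (E : 4 * PI * t * / t <= 4 * PI * t * (1 + z) ^ 2)
    by (apply Rmult_le_compat_l; [lra | nra]).
  replace (4 * PI * t * / t) with (4 * PI) in E by (field; lra). lra.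
Qed.

(** Arises from bounding [(1 + z)^(k + 3) exp (- z / 4)] through [v = (1 + z) / 4], using
    [v^(k + 3) <= (k + 3)! exp v]; the shift from [z] to [1 + z] leaves [exp (/ 4)]. *)
Definition Phi_bound (k : nat) : R :=
  INR (Factorial.fact k) * (4 ^ (k + 3) * INR (Factorial.fact (k + 3)) * exp (/ 4)).

(** The exponent [k + 3] collects [k] powers from [Phi_deriv_le_Phi], one from [Phi_le] and two from
    the weight, which is retained to obtain flatness at time 0. *)
Lemma Phi_deriv_decay k y t : 1 <= y -> 0 < t ->
  Rabs (Phi_deriv k y t) * (1 + y ^ 2 / t) ^ 2 <= Phi_bound k.
Proof.
  intros Hy Ht. set (z := y ^ 2 / t).
  assert (Hz : 0 < z) by (apply Rdiv_lt_0_compat; nra).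
  apply Rle_trans with (INR (Factorial.fact k) * ((1 + z) ^ (k + 3) * exp (- z / 4))).
  - apply Rle_trans with
      (INR (Factorial.fact k) * (1 + z) ^ k * ((1 + z) * exp (- z / 4)) * (1 + z) ^ 2).
    + apply Rmult_le_compat_r; [nra |].
      eapply Rle_trans; [now apply Phi_deriv_le_Phi |].
      apply Rmult_le_compat_l; [| now apply Phi_le].
      apply Rmult_le_pos; [apply pos_INR | apply pow_le; fold z; lra].
    + right. rewrite pow_add. ring.
  - unfold Phi_bound. apply Rmult_le_compat_l; [apply pos_INR |].
    assert (E := pow_le_fact_exp ((1 + z) / 4) (k + 3) ltac:(lra)).
    replace (- z / 4) with (/ 4 + - ((1 + z) / 4)) by field.
    replace ((1 + z) ^ (k + 3)) with (4 ^ (k + 3) * ((1 + z) / 4) ^ (k + 3))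
      by (rewrite <- Rpow_mult_distr; f_equal; field).
    rewrite exp_plus, exp_Ropp. pose proof (exp_pos ((1 + z) / 4)) as He.
    set (w := exp ((1 + z) / 4)) in *.
    replace (4 ^ (k + 3) * ((1 + z) / 4) ^ (k + 3) * (exp (/ 4) * / w))
      with (4 ^ (k + 3) * exp (/ 4) * (((1 + z) / 4) ^ (k + 3) * / w)) by ring.
    replace (4 ^ (k + 3) * INR (Factorial.fact (k + 3)) * exp (/ 4))
      with (4 ^ (k + 3) * exp (/ 4) * INR (Factorial.fact (k + 3))) by ring.
    apply Rmult_le_compat_l.
    + apply Rmult_le_pos; [apply pow_le; lra | left; apply exp_pos].
    + apply Rle_div_l; [trivial | exact E].
Qed.

Lemma Phi_bound_pos k : 0 < Phi_bound k.
Proof.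
  unfold Phi_bound. repeat apply Rmult_lt_0_compat; try apply INR_fact_lt_0.
  - apply pow_lt; lra.
  - apply exp_pos.
Qed.

Lemma Phi_deriv_bounded k y t : 1 <= y -> Rabs (Phi_deriv k y t) <= Phi_bound k.
Proof.
  intros Hy. destruct (Rlt_le_dec 0 t) as [Ht | Ht].
  - assert (Hz : 0 < y ^ 2 / t) by (apply Rdiv_lt_0_compat; nra).
    eapply Rle_trans; [| exact (Phi_deriv_decay k y t Hy Ht)].
    rewrite <- (Rmult_1_r (Rabs _)) at 1.
    apply Rmult_le_compat_l; [apply Rabs_pos | apply pow_R1_Rle; lra].
  - rewrite Phi_deriv_nonpos, Rabs_R0 by trivial. left; apply Phi_bound_pos.
Qed.

(** Since [/ t <= 1 + y ^ 2 / t], the weight in [Phi_deriv_decay] turns into [t ^ 2]. Quadratic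
    flatness is what differentiation across time 0 requires. *)
Lemma Phi_deriv_flat k y t : 1 <= y -> Rabs (Phi_deriv k y t) <= Phi_bound k * t ^ 2.
Proof.
  intros Hy. destruct (Rlt_le_dec 0 t) as [Ht | Ht].
  - pose proof (Phi_deriv_decay k y t Hy Ht) as E. pose proof (Rabs_pos (Phi_deriv k y t)).
    apply Rmult_le_reg_r with ((/ t) ^ 2).
    { apply pow_lt, Rinv_0_lt_compat, Ht. }
    replace (Phi_bound k * t ^ 2 * (/ t) ^ 2) with (Phi_bound k) by (field; lra).
    eapply Rle_trans; [| exact E]. apply Rmult_le_compat_l; trivial.
    assert (0 < / t) by now apply Rinv_0_lt_compat.
    assert (/ t * 1 <= / t * y ^ 2) by (apply Rmult_le_compat_l; [lra | now apply pow_R1_Rle]).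
    apply pow_incr. unfold Rdiv. lra.
  - rewrite Phi_deriv_nonpos, Rabs_R0 by trivial.
    apply Rmult_le_pos; [left; apply Phi_bound_pos | apply pow2_ge_0].
Qed.

Lemma Phi_family :
  bounded_heat_family (fun k x t => Phi_deriv k (x + 1) t) Phi_bound.
Proof.
  apply bounded_heat_family_of_derive; intros k x t Hx.
  - apply Phi_deriv_bounded. lra.
  - destruct (Rlt_le_dec 0 t) as [Ht | Ht].
    + assert (E := Phi_deriv_space k (x + 1) t Ht).
      auto_derive; [eexists; exact E |]. rewrite (is_derive_unique (fun y : R => Phi_deriv k y t) _ _ E). ring.
    + apply (is_derive_ext (fun _ => 0)).
      { intros y. now rewrite Phi_deriv_nonpos. }
      rewrite Phi_deriv_nonpos by trivial. apply (is_derive_const 0).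
  - destruct (Rlt_le_dec 0 t) as [Ht | Ht]; [now apply Phi_deriv_time |].
    (* This includes [t = 0]: the value and the proposed derivative vanish at [t], and for
       [s > 0 >= t] flatness suffices because [s ^ 2 <= (s - t) ^ 2]. *)
    apply is_derive_of_quadratic with (Phi_bound k). intros s.
    rewrite (Phi_deriv_nonpos k _ t), (Phi_deriv_nonpos (S (S k)) _ t) by trivial.
    rewrite Rmult_0_r, !Rminus_0_r. destruct (Rlt_le_dec 0 s) as [Hs | Hs].
    + eapply Rle_trans; [apply Phi_deriv_flat; lra |].
      apply Rmult_le_compat_l; [left; apply Phi_bound_pos | apply pow_incr; lra].
    + rewrite Phi_deriv_nonpos, Rabs_R0 by trivial.
      apply Rmult_le_pos; [left; apply Phi_bound_pos | apply pow2_ge_0].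
Qed.

(** * The series of kernels *)

Lemma bounded_heat_family_shift (H : nat -> R -> R -> R) (M : nat -> R) (c s : R) :
  0 <= c -> bounded_heat_family H M ->
  bounded_heat_family (fun k x t => c * H k x (t - s)) (fun k => c * M k).
Proof.
  intros Hc [Hb Hx Ht]. split.
  - intros k x t H0. rewrite Rabs_mult, (Rabs_pos_eq c) by trivial.
    apply Rmult_le_compat_l; auto.
  - intros k x y t H0 H1.
    replace (c * H k y (t - s) - c * H k x (t - s) - (y - x) * (c * H (S k) x (t - s)))
      with (c * (H k y (t - s) - H k x (t - s) - (y - x) * H (S k) x (t - s))) by ring.
    rewrite Rabs_mult, (Rabs_pos_eq c), Rmult_assoc by trivial.
    apply Rmult_le_compat_l; auto.
  - intros k x t' t H0.
    replace (c * H k x (t - s) - c * H k x (t' - s) - (t - t') * (c * H (S (S k)) x (t' - s)))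
      with (c * (H k x (t - s) - H k x (t' - s)
                 - ((t - s) - (t' - s)) * H (S (S k)) x (t' - s))) by ring.
    rewrite Rabs_mult, (Rabs_pos_eq c), Rmult_assoc by trivial.
    apply Rmult_le_compat_l; trivial.
    replace ((t - t') ^ 2) with (((t - s) - (t' - s)) ^ 2) by ring. auto.
Qed.

Lemma is_series_inv_pow2 : is_series (fun n => / 2 ^ S n) 1.
Proof.
  replace 1 with (/ 2 * / (1 - / 2)) by field.
  eapply is_series_ext; [| apply (is_series_scal (V := R_NormedModule) (/ 2)),
    is_series_geom; rewrite Rabs_pos_eq; lra].
  intros n. unfold scal; simpl. unfold mult; simpl.
  rewrite pow_inv, Rinv_mult. reflexivity.
Qed.

Lemma is_series_inv_pow2_tail (m : nat) :
  is_series (fun n => if Nat.leb n m then 0 else / 2 ^ S n) (/ 2 ^ S m).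
Proof.
  induction m as [| m IH].
  - apply is_series_decr_1. unfold plus, opp; simpl.
    replace (/ (2 * 1) + - 0) with (/ 2 * 1) by field.
    eapply is_series_ext; [| apply (is_series_scal (V := R_NormedModule) (/ 2)),
      is_series_inv_pow2].
    intros n. unfold scal; simpl. unfold mult; simpl. rewrite !Rinv_mult. ring.
  - apply is_series_decr_1. unfold plus, opp; simpl.
    replace (/ (2 * (2 * 2 ^ m)) + - 0) with (/ 2 * / 2 ^ S m)
      by (simpl; field; apply pow_nonzero; lra).
    eapply is_series_ext; [| apply (is_series_scal (V := R_NormedModule) (/ 2)), IH].
    intros n. unfold scal; simpl. unfold mult; simpl.
    destruct (Nat.leb n m); [ring |]. rewrite !Rinv_mult. ring.
Qed.

Lemma u2_family (r : nat -> R) : bounded_heat_family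
  (fun k x t => Series (fun n => / 2 ^ S n * Phi_deriv k (x + 1) (t - r n)))
  (fun k => Series (fun n => / 2 ^ S n * Phi_bound k)).
Proof.
  apply (bounded_heat_family_series
    (fun n k x t => / 2 ^ S n * Phi_deriv k (x + 1) (t - r n))
    (fun n k => / 2 ^ S n * Phi_bound k)).
  - intros n. apply (bounded_heat_family_shift (fun k x t => Phi_deriv k (x + 1) t)).
    + left. apply Rinv_0_lt_compat, pow_lt. lra.
    + exact Phi_family.
  - intros k. apply ex_series_scal_r. exists 1. exact is_series_inv_pow2.
Qed.

(** * Non-analyticity of the series of kernels *)

Lemma fact_div2_step k :
  (k * Factorial.fact (Nat.div2 (pred k)) <= 2 * Factorial.fact (Nat.div2 (S k)))%nat.
Proof.
  destruct k as [| j]; [simpl; lia |].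
  change (Nat.div2 (S (S j))) with (S (Nat.div2 j)).
  change (pred (S j)) with j.
  change (Factorial.fact (S (Nat.div2 j)))
    with (S (Nat.div2 j) * Factorial.fact (Nat.div2 j))%nat.
  pose proof (Nat.div2_odd j) as E.
  assert (Nat.b2n (Nat.odd j) <= 1)%nat by (destruct (Nat.odd j); simpl; lia). nia.
Qed.

(** Growth like the factorial of [k / 2] in space becomes growth like [n!] for the [n]-th time
    derivative. By [fact_div2_step] the second term of the recurrence is at most [2 * F], so a step
    costs at most [(y + 2) / (2 t)], hence at most [B]. *)
Lemma Phi_deriv_away (y e : R) (k : nat) (t : R) : 1 <= y -> 0 < e -> e <= t ->
  Rabs (Phi_deriv k y t)
    <= (1 + (y + 2) / e) ^ k * INR (Factorial.fact (Nat.div2 k)) * Phi_bound 0.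
Proof.
  intros Hy He Ht. set (B := 1 + (y + 2) / e).
  assert (HB : 1 <= B).
  { unfold B. assert (0 < (y + 2) / e) by (apply Rdiv_lt_0_compat; lra). lra. }
  assert (Het : / t <= / e) by (apply Rinv_le_contravar; lra).
  assert (Ht' : 0 < / t) by (apply Rinv_0_lt_compat; lra).
  pose proof (Phi_bound_pos 0) as HM.
  induction k as [| k H1 H2] using nat_ind_pred.
  - simpl pow. simpl Factorial.fact. simpl INR. rewrite !Rmult_1_l.
    now apply Phi_deriv_bounded.
  - rewrite Phi_deriv_S, Rabs_mult, Rabs_Ropp, Rinv_mult, (Rabs_pos_eq (/ 2 * / t)) by lra.
    set (F := B ^ k * INR (Factorial.fact (Nat.div2 (S k))) * Phi_bound 0).
    assert (HBk : 0 < B ^ k) by (apply pow_lt; lra).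
    assert (HF : 0 <= F).
    { unfold F. apply Rmult_le_pos; [apply Rmult_le_pos; [lra | apply pos_INR] | lra]. }
    assert (H1' : Rabs (Phi_deriv k y t) <= F).
    { eapply Rle_trans; [exact H1 |]. unfold F.
      apply Rmult_le_compat_r; [lra |]. apply Rmult_le_compat_l; [lra |].
      apply le_INR, Factorial.fact_le, Nat.div2_le_mono. lia. }
    assert (H2' : INR k * Rabs (Phi_deriv (pred k) y t) <= 2 * F).
    { eapply Rle_trans; [apply Rmult_le_compat_l; [apply pos_INR | exact H2] |].
      apply Rle_trans with
        (B ^ k * (INR k * INR (Factorial.fact (Nat.div2 (pred k)))) * Phi_bound 0).
      - rewrite <- !Rmult_assoc. apply Rmult_le_compat_r; [lra |].
        apply Rmult_le_compat_r; [apply pos_INR |]. rewrite Rmult_comm.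
        apply Rmult_le_compat_r; [apply pos_INR |]. apply Rle_pow; [lra | lia].
      - replace (2 * F) with
          (B ^ k * (2 * INR (Factorial.fact (Nat.div2 (S k)))) * Phi_bound 0)
          by (unfold F; ring).
        apply Rmult_le_compat_r; [lra |]. apply Rmult_le_compat_l; [lra |].
        change 2 with (INR 2). rewrite <- !mult_INR. apply le_INR, fact_div2_step. }
    apply Rle_trans with (/ 2 * / t * (y * F + 2 * F)).
    + apply Rmult_le_compat_l; [lra |].
      eapply Rle_trans; [apply Rabs_triang |].
      rewrite !Rabs_mult, (Rabs_pos_eq y), (Rabs_pos_eq (INR k)) by (lra || apply pos_INR).
      apply Rplus_le_compat; [apply Rmult_le_compat_l; lra | exact H2'].
    + rewrite <- tech_pow_Rmult.
      replace (B * B ^ k * INR (Factorial.fact (Nat.div2 (S k))) * Phi_bound 0)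
        with (B * F) by (unfold F; ring).
      replace (/ 2 * / t * (y * F + 2 * F)) with ((y + 2) * (/ 2 * / t) * F) by ring.
      apply Rmult_le_compat_r; trivial.
      assert ((y + 2) * (/ 2 * / t) <= (y + 2) / e)
        by (unfold Rdiv; apply Rmult_le_compat_l; lra).
      unfold B. lra.
Qed.

Lemma rational_dense (x d : R) : 0 < d -> exists p : Q, Rabs (Q2R p - x) < d.
Proof.
  intros Hd. assert (Hd' : 0 < / d) by now apply Rinv_0_lt_compat.
  destruct (archimed (/ d)) as [H1 _].
  assert (Hn : (0 < up (/ d))%Z) by (apply lt_IZR; lra).
  destruct (up (/ d)) as [| n |]; try lia. clear Hn.
  assert (Hn : 0 < IZR (Z.pos n)) by lra.
  destruct (archimed (x * IZR (Z.pos n))) as [H2 H3].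
  exists (up (x * IZR (Z.pos n)) # n)%Q. unfold Q2R. simpl Qnum. simpl Qden.
  set (u := IZR (up (x * IZR (Z.pos n)))) in *. set (v := IZR (Z.pos n)) in *.
  assert (Hv : / v < d).
  { rewrite <- (Rinv_inv d). apply Rinv_lt_contravar; [apply Rmult_lt_0_compat; lra | lra]. }
  replace (u * / v - x) with ((u - x * v) * / v) by (field; lra).
  assert (Hv0 : 0 < / v) by now apply Rinv_0_lt_compat.
  rewrite Rabs_mult, !Rabs_pos_eq by lra.
  apply Rle_lt_trans with (1 * / v); [apply Rmult_le_compat_r; lra | lra].
Qed.

Lemma isolated_in_finite_prefix (r : nat -> R) (r_inj : forall n m : nat, r n = r m -> n = m)
  (m N : nat) :
  exists e, 0 < e /\ forall j, (j < N)%nat -> j <> m -> e <= Rabs (r m - r j).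
Proof.
  induction N as [| N [e [He IH]]].
  - exists 1. split; [lra | lia].
  - destruct (Nat.eq_dec N m) as [-> | HN].
    + exists e. split; trivial. intros j Hj Hjm. apply IH; lia.
    + assert (H0 : 0 < Rabs (r m - r N)).
      { apply Rabs_pos_lt. intros H. apply HN, r_inj. lra. }
      exists (Rmin e (Rabs (r m - r N))). split; [now apply Rmin_glb_lt |].
      intros j Hj Hjm. destruct (Nat.eq_dec j N) as [-> | HjN]; [apply Rmin_r |].
      eapply Rle_trans; [apply Rmin_l |]. apply IH; lia.
Qed.

(** The share 3/4 has to exceed 1/2, because in the series of kernels the weights beyond index
    [m + 1] add up to half the weight of index [m]. *)
Lemma sup_nearly_attained (f : R -> R) (M : R) :
  (forall t, Rabs (f t) <= M) ->
  exists S, (forall t, Rabs (f t) <= S) /\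
    (0 < S -> exists t, 3 / 4 * S < Rabs (f t)).
Proof.
  intros HM.
  destruct (completeness (fun v => exists t, v = Rabs (f t))) as [S [Hub Hlub]].
  - exists M. intros v [t ->]. apply HM.
  - exists (Rabs (f 0)). now exists 0.
  - exists S. split.
    + intros t. apply Hub. now exists t.
    + intros HS. apply Classical_Prop.NNPP. intros Hno.
      assert (S <= 3 / 4 * S); [| lra].
      apply Hlub. intros v [t ->]. apply Rnot_lt_le. intros Ht. apply Hno. now exists t.
Qed.

(* Gevrey-1 bounds on the whole line would make the flat function [Phi y] vanish near 0. *)
Lemma Phi_not_analytic_bound (y C A : R) : 1 <= y -> 0 < A ->
  ~ (forall n t, Rabs (Phi_deriv (n + n) y t) <= C * A ^ n * INR (Factorial.fact n)).
Proof.
  intros Hy HA Hall.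
  assert (HA' : 0 < / A) by now apply Rinv_0_lt_compat.
  (* With [s * A = 1/2], the Taylor remainder at [s] is at most [C * (/ 2) ^ S N]. *)
  set (s := / (2 * A)).
  assert (Hs : 0 < s) by (unfold s; rewrite Rinv_mult; lra).
  assert (HPhi := Phi_gt_0 y s Hs).
  assert (HC : 0 <= C).
  { specialize (Hall 0%nat 0). simpl in Hall. pose proof (Rabs_pos (Phi y 0)). lra. }
  assert (Hq : 0 < Phi y s / (C + 1)) by (apply Rdiv_lt_0_compat; lra).
  destruct (pow_lt_1_zero (/ 2) ltac:(rewrite Rabs_pos_eq; lra) _ Hq) as [N HN].
  specialize (HN (S N) ltac:(lia)).
  assert (HD : forall n t, Derive_n (fun t => Phi_deriv 0 y t) n t = Phi_deriv (n + n) y t).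
  { intros n t. replace y with (y - 1 + 1) by ring.
    apply (bhf_Derive_n _ _ Phi_family (y - 1)). lra. }
  destruct (Taylor_Lagrange (fun t => Phi_deriv 0 y t) N 0 s Hs) as [z [Hz E]].
  { intros t Ht k Hk. replace y with (y - 1 + 1) by ring.
    apply (bhf_ex_derive_n _ _ Phi_family (y - 1)). lra. }
  (* All derivatives vanish at time 0, so the Taylor polynomial drops out and [Phi y s] equals its
     remainder. *)
  rewrite sum_eq_R0 in E.
  2:{ intros n Hn. rewrite HD, Phi_deriv_nonpos by lra. ring. }
  rewrite HD, Rplus_0_l, Rminus_0_r in E. simpl (Phi_deriv 0 y s) in E.
  specialize (Hall (S N) z).
  assert (Hf := INR_fact_lt_0 (S N)).
  assert (HsN : 0 < s ^ S N) by now apply pow_lt.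
  assert (H1 : Phi y s <= s ^ S N / INR (Factorial.fact (S N))
                 * (C * A ^ S N * INR (Factorial.fact (S N)))).
  { rewrite E. eapply Rle_trans; [apply Rle_abs |].
    rewrite Rabs_mult, (Rabs_pos_eq (_ / _)) by (left; now apply Rdiv_lt_0_compat).
    apply Rmult_le_compat_l; [left; now apply Rdiv_lt_0_compat | exact Hall]. }
  replace (s ^ S N / INR (Factorial.fact (S N)) * (C * A ^ S N * INR (Factorial.fact (S N))))
    with (C * (s ^ S N * A ^ S N)) in H1 by (field; lra).
  rewrite <- Rpow_mult_distr in H1.
  replace (s * A) with (/ 2) in H1 by (unfold s; field; lra).
  rewrite Rabs_pos_eq in HN by (apply pow_le; lra).
  apply Rlt_div_r in HN; [| lra].
  assert (0 < (/ 2) ^ S N) by (apply pow_lt; lra). nra.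
Qed.

Lemma u2_not_analytic (r : nat -> R)
  (r_inj : forall n m : nat, r n = r m -> n = m)
  (r_onto : forall q : R, (exists p : Q, q = Q2R p) <-> (exists n : nat, r n = q)) x t :
  0 <= x -> ~ real_analytic_at (fun s => u2 r x s) t.
Proof.
  intros Hx Han.
  destruct (real_analytic_at_bound _ _ Han) as (C & A & d & HC & HA & Hd & Hbound).
  destruct (rational_dense t (d / 2) ltac:(lra)) as [p Hp].
  destruct (proj1 (r_onto (Q2R p)) ltac:(now exists p)) as [m Hm]. rewrite <- Hm in Hp.
  destruct (isolated_in_finite_prefix r r_inj m (S (S m))) as [e0 [He0 Hiso]].
  (* For [0 < s < e], the first half keeps [r m + s] at distance more than [e] from the other [r j]
     with [j <= m + 1], and the second keeps it within [d] of [t]. *)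
  set (e := Rmin (e0 / 2) (d / 2)).
  assert (He : 0 < e) by (apply Rmin_glb_lt; lra).
  assert (He1 : e <= e0 / 2) by apply Rmin_l.
  assert (He2 : e <= d / 2) by apply Rmin_r.
  set (y := x + 1). assert (Hy : 1 <= y) by (unfold y; lra).
  set (B := (1 + (y + 2) / e) ^ 2).
  assert (HB : 0 < B).
  { apply pow_lt. assert (0 < (y + 2) / e) by (apply Rdiv_lt_0_compat; lra). lra. }
  assert (HM := Phi_bound_pos 0).
  assert (Haway : forall n s, e <= s -> Rabs (Phi_deriv (n + n) y s)
                    <= Phi_bound 0 * B ^ n * INR (Factorial.fact n)).
  { intros n s Hs. eapply Rle_trans; [now apply Phi_deriv_away with (e := e) |].
    right. unfold B. rewrite <- pow_mult. replace (n + n)%nat with (2 * n)%nat by lia.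
    rewrite Nat.div2_even. ring. }
  set (A' := Rmax A B).
  assert (HAA : A <= A') by apply Rmax_l. assert (HBA : B <= A') by apply Rmax_r.
  (* The inverse of the surplus [3/4 * 2^(-(m + 1)) - 2^(-(m + 2))] of term [m] over the tail,
     computed in [Hgap]. *)
  set (P := 2 ^ S (S (S m))). assert (HP : 1 <= P) by (apply pow_R1_Rle; lra).
  apply (Phi_not_analytic_bound y (P * (C + Phi_bound 0)) A' Hy ltac:(lra)).
  intros n.
  set (G := INR (Factorial.fact n)). assert (HG : 0 < G) by apply INR_fact_lt_0.
  assert (HAn : A ^ n <= A' ^ n) by (apply pow_incr; lra).
  assert (HBn : B ^ n <= A' ^ n) by (apply pow_incr; lra).
  assert (HAn0 : 0 < A ^ n) by now apply pow_lt.
  assert (HBn0 : 0 < B ^ n) by now apply pow_lt.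
  set (b := Phi_bound 0 * B ^ n * G).
  assert (Hb0 : 0 < b) by (apply Rmult_lt_0_compat; [apply Rmult_lt_0_compat |]; lra).
  assert (Htotal : P * (C * A ^ n * G + b) <= P * (C + Phi_bound 0) * A' ^ n * G).
  { rewrite !Rmult_assoc. apply Rmult_le_compat_l; [lra |].
    unfold b. replace ((C + Phi_bound 0) * (A' ^ n * G))
      with (C * (A' ^ n * G) + Phi_bound 0 * (A' ^ n * G)) by ring.
    rewrite !Rmult_assoc.
    apply Rplus_le_compat; (apply Rmult_le_compat_l; [lra |]);
      apply Rmult_le_compat_r; lra. }
  assert (HCAG : 0 < C * A ^ n * G) by (repeat apply Rmult_lt_0_compat; lra).
  destruct (sup_nearly_attained (Phi_deriv (n + n) y) (Phi_bound (n + n)))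
    as [M [HS Hnear]].
  { intros s. now apply Phi_deriv_bounded. }
  intros s0. eapply Rle_trans; [apply HS |]. eapply Rle_trans; [| exact Htotal].
  clear s0 Htotal.
  destruct (Rle_lt_dec M 0) as [HS0 | HS0]; [nra |].
  destruct (Hnear HS0) as [s Hs].
  (* For [s >= e] the bound is direct, and for [s <= 0] the kernel vanishes although its derivative
     is nearly extremal there. The essential case is [0 < s < e]. *)
  destruct (Rle_lt_dec e s) as [Hes | Hes].
  { specialize (Haway n s Hes). fold G in Haway. fold b in Haway.
    assert (M <= 2 * b) by lra.
    assert (2 <= P).
    { unfold P. rewrite <- tech_pow_Rmult.
      assert (1 <= 2 ^ S (S m)) by (apply pow_R1_Rle; lra). lra. }
    nra. }
  destruct (Rle_lt_dec s 0) as [Hs0 | Hs0].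
  { rewrite Phi_deriv_nonpos, Rabs_R0 in Hs by trivial. lra. }
  assert (Hts : Rabs (r m + s - t) < d).
  { replace (r m + s - t) with ((r m - t) + s) by ring.
    eapply Rle_lt_trans; [apply Rabs_triang |]. rewrite (Rabs_pos_eq s); lra. }
  specialize (Hbound n _ Hts). fold G in Hbound.
  assert (Hpow : forall j, 0 < / 2 ^ j)
    by (intros j; apply Rinv_0_lt_compat, pow_lt; lra).
  set (f := fun j => / 2 ^ S j * Phi_deriv (n + n) y (r m + s - r j)).
  change (Rabs (Derive_n (fun s => Series (fun j => / 2 ^ S j
    * Phi_deriv 0 (x + 1) (s - r j))) n (r m + s)) <= C * A ^ n * G) in Hbound.
  rewrite (bhf_Derive_n _ _ (u2_family r) x Hx) in Hbound.
  change (Rabs (Series f) <= C * A ^ n * G) in Hbound.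
  (* This majorant bounds every term except the [m]-th: [b] serves the indices up to [m + 1], and
     the supremum [M] serves the tail. *)
  assert (Hser : is_series (fun j => / 2 ^ S j * b
      + (if Nat.leb j (S m) then 0 else / 2 ^ S j) * M)
      (1 * b + / 2 ^ S (S m) * M)).
  { apply (is_series_plus (V := R_NormedModule));
      apply is_series_scal_r; [apply is_series_inv_pow2 | apply is_series_inv_pow2_tail]. }
  assert (E := Series_isolate f
    (fun j => / 2 ^ S j * b + (if Nat.leb j (S m) then 0 else / 2 ^ S j) * M) m).
  cbv beta in E. rewrite (is_series_unique _ _ Hser) in E.
  assert (E' : Rabs (f m) - (1 * b + / 2 ^ S (S m) * M) <= Rabs (Series f)).
  { apply E.
    - intros j Hj. unfold f. rewrite Rabs_mult, (Rabs_pos_eq (/ _)) by (left; apply Hpow).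
      destruct (Nat.leb_spec j (S m)) as [Hjm | Hjm].
      + rewrite Rmult_0_l, Rplus_0_r. apply Rmult_le_compat_l; [left; apply Hpow |].
        specialize (Hiso j ltac:(lia) Hj).
        (* Either the [j]-th singularity lies at least [e] in the past, or, by isolation, it lies in
           the future, where the kernel is zero. *)
        destruct (Rle_lt_dec e (r m + s - r j)) as [Hj1 | Hj1]; [now apply Haway |].
        rewrite Phi_deriv_nonpos, Rabs_R0; [lra |].
        destruct (Rle_lt_dec 0 (r m - r j)) as [H0 | H0].
        * rewrite Rabs_pos_eq in Hiso by trivial. lra.
        * rewrite Rabs_left in Hiso by trivial. lra.
      + rewrite <- (Rplus_0_l (_ * Rabs _)). apply Rplus_le_compat.
        * apply Rmult_le_pos; [left; apply Hpow | lra].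
        * apply Rmult_le_compat_l; [left; apply Hpow | apply HS].
    - rewrite (proj2 (Nat.leb_le m (S m))) by lia.
      rewrite Rmult_0_l, Rplus_0_r. apply Rmult_le_pos; [left; apply Hpow | lra].
    - eexists. exact Hser. }
  clear E.
  assert (Hfm : / 2 ^ S m * (3 / 4 * M) <= Rabs (f m)).
  { unfold f. rewrite Rabs_mult, (Rabs_pos_eq (/ _)) by (left; apply Hpow).
    replace (r m + s - r m) with s by ring.
    apply Rmult_le_compat_l; [left; apply Hpow | lra]. }
  assert (Hgap : / 2 ^ S m * (3 / 4 * M) - / 2 ^ S (S m) * M = M / P).
  { unfold P. simpl. field. apply pow_nonzero. lra. }
  assert (HMP : M / P <= C * A ^ n * G + b) by lra.
  apply Rle_div_l in HMP; lra.
Qed.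

Theorem theorem1p1 (r : nat -> R)
  (r_inj : forall n m : nat, r n = r m -> n = m)
  (r_onto : forall q : R, (exists p : Q, q = Q2R p) <-> (exists n : nat, r n = q)) :
  heat_props u1 /\ heat_props (u2 r).
Proof.
  split; split.
  - apply (bhf_smooth _ _ _ wave_series_family).
    intros x t _. symmetry. apply u1_wave_series.
  - split.
    + eexists. intros x t Hx. rewrite u1_wave_series.
      apply (bhf_bound _ _ wave_series_family 0%nat). lra.
    + intros x t Hx. now apply u1_not_analytic.
  - apply (bhf_smooth _ _ _ (u2_family r)). reflexivity.
  - split.
    + eexists. intros x t Hx. apply (bhf_bound _ _ (u2_family r) 0%nat). lra.
    + intros x t Hx. now apply u2_not_analytic.
Qed.
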